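(* Let $a<b$ be positive integers with $\gcd(a,b)=1$. Let $C$ be a smooth curve of genus $g=(a-1)(b-1)/2$ and assume $C$ has a Weierstrass point with Weierstrass semigroup $\langle a;b\rangle$. If $b\neq a+1$, then $C$ has a unique linear system $g^1_a$.
   Context: Curves are smooth, irreducible, projective, over $\mathbb{C}$. $\langle a;b\rangle$ denotes the subsemigroup of $\mathbb{N}$ generated by $a$ and $b$. For a point $P\in C$, its Weierstrass semigroup is $\mathrm{WS}(P)=\{0\}\cup\{m\in\mathbb{N}: |mP| \text{ is base point free}\}$; $P$ is a Weierstrass point if $\mathbb{N}\setminus\mathrm{WS}(P)\neq\{1,2,\dots,g\}$. A $g^1_a$ is a linear system of degree $a$ and (projective) dimension $1$ on $C$. *)

(* Defs.v *)
From HB Require Import structures.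
From mathcomp Require Import all_boot all_order all_algebra.
From mathcomp Require Import boolp classical_sets reals.
From mathcomp.real_closed Require Import complex.
From mathcomp Require Import mpoly freeg.

Set Implicit Arguments.
Unset Strict Implicit.
Unset Printing Implicit Defensive.

Import Order.TTheory GRing.Theory Num.Theory.

Local Open Scope ring_scope.
Local Open Scope complex_scope.
Local Open Scope classical_set_scope.

(* The points of P^n over the complex numbers are the lines of C^(n+1). *)
Definition proj_space (R : realType) (n : nat) : Type :=
  {L : {vspace 'rV[R[i]]_n.+1} | \dim L == 1%N}.

HB.instance Definition _ (R : realType) (n : nat) :=
  SubChoice.on (proj_space R n).

Section ProjectiveSets.
Variables (R : realType) (n : nat).
Implicit Types (F : {mpoly R[i][n.+1]}) (P : proj_space R n)
  (Y Z : set (proj_space R n)).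

Definition form_of_degree (d : nat) F : Prop := F \is d.-homog.

Definition form F : Prop := exists d, form_of_degree d F.

Definition vanishes_at F P : Prop :=
  forall x : 'rV[R[i]]_n.+1, x \in val P -> F.@[x 0] = 0.

Definition vanishes_on F Z : Prop := forall P, Z P -> vanishes_at F P.

Definition proj_closed Z : Prop :=
  exists2 S : set {mpoly R[i][n.+1]}, (forall F, S F -> form F)
    & Z = [set P | forall F, S F -> vanishes_at F P].

Definition closed_irreducible Z : Prop :=
  [/\ proj_closed Z, Z !=set0
    & forall Y1 Y2, proj_closed Y1 -> proj_closed Y2 ->
        Z `<=` Y1 `|` Y2 -> Z `<=` Y1 \/ Z `<=` Y2].

Definition has_chain Z (k : nat) : Prop :=
  exists Y : nat -> set (proj_space R n),
    (forall i, (i <= k)%N -> closed_irreducible (Y i) /\ Y i `<=` Z) /\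
    (forall i, (i < k)%N -> Y i `<` Y i.+1).

Definition has_dimension Z (k : nat) : Prop :=
  has_chain Z k /\ ~ has_chain Z k.+1.

(* Clearing denominators, a nonzero element of the local ring of Z at P is the
   class of F / H with F, H forms of the same degree, F nonzero on Z and
   H nonzero at P.  [local_order Z P T F k] says that, in that ring,
   F = unit * T ^ k once F and T are divided by forms not vanishing at P; the
   homogeneous equality V * F = U * T ^ k on Z forces the degrees to agree
   whenever F is not identically zero on Z. *)
Definition local_order Z P (T F : {mpoly R[i][n.+1]}) (k : nat) : Prop :=
  exists U V : {mpoly R[i][n.+1]},
    [/\ form U, form V, ~ vanishes_at U P, ~ vanishes_at V P
      & vanishes_on (V * F - U * T ^+ k) Z].

(* T is a uniformizer of the local ring of Z at P. *)
Definition uniformizer Z P (T : {mpoly R[i][n.+1]}) : Prop :=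
  [/\ form T, vanishes_at T P, ~ vanishes_on T Z
    & forall F, form F -> ~ vanishes_on F Z -> exists k, local_order Z P T F k].

(* A point of a curve is nonsingular when its local ring is a discrete
   valuation ring, that is, when it has a uniformizer. *)
Definition smooth_projective_curve Z : Prop :=
  [/\ closed_irreducible Z, has_dimension Z 1
    & forall P, Z P -> exists T, uniformizer Z P T].

End ProjectiveSets.

Section Divisors.
Variables (R : realType) (n : nat) (C : set (proj_space R n)).
Implicit Types (F G : {mpoly R[i][n.+1]}) (P Q : set_type C).

Definition divisor := {freeg (set_type C) / int}.
Implicit Types (D E : divisor).

Definition effective D : Prop := forall P, 0 <= coeff P D.

Definition order_at P F (k : nat) : Prop :=
  exists2 T, uniformizer C (val P) T & local_order C (val P) T F k.

Definition form_divisor F D : Prop :=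
  forall P, exists2 k : nat, order_at P F k & coeff P D = k%:Z.

(* A rational function on C is F / G for forms F and G of the same degree, with
   G not vanishing identically on C; its divisor is div F - div G. *)
Definition fun_divisor F G E : Prop :=
  exists DF DG : divisor,
    [/\ form_divisor F DF, form_divisor G DG & E = DF - DG].

Definition linearly_equivalent D E : Prop :=
  exists (m : nat) F G,
    [/\ form_of_degree m F, form_of_degree m G,
        ~ vanishes_on F C, ~ vanishes_on G C & fun_divisor F G (D - E)].

Definition complete_linear_system D : set divisor :=
  [set E | effective E /\ linearly_equivalent E D].

Definition base_point_free (L : set divisor) : Prop :=
  forall Q, exists2 E, L E & coeff Q E = 0.

Definition lin_comb (r : nat) (s : 'I_r -> {mpoly R[i][n.+1]})
  (c : 'I_r -> R[i]) : {mpoly R[i][n.+1]} := \sum_(j < r) c j *: s j.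

(* The fractions s j / G, j < r, are linearly independent elements of the
   Riemann-Roch space L(D); finitely many rational functions always have a
   common denominator. *)
Definition independent_sections D (r : nat) (s : 'I_r -> {mpoly R[i][n.+1]}) G :
    Prop :=
  exists m : nat,
    [/\ (forall j, form_of_degree m (s j)), form_of_degree m G,
        ~ vanishes_on G C
      & forall c : 'I_r -> R[i], (exists j, c j != 0) ->
          ~ vanishes_on (lin_comb s c) C /\
          exists2 E, fun_divisor (lin_comb s c) G E & effective (D + E)].

(* l(D) >= r *)
Definition ell_ge D (r : nat) : Prop := exists s G, @independent_sections D r s G.

(* A linear system of degree d and dimension r: the divisors D + div f for f
   nonzero in an (r+1)-dimensional linear subspace of L(D), with deg D = d. *)
Definition is_linear_system (r d : nat) (L : set divisor) : Prop :=
  exists D (s : 'I_r.+1 -> {mpoly R[i][n.+1]}) G,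
    [/\ deg D = d%:Z, independent_sections D s G
      & L = [set E | exists2 c : 'I_r.+1 -> R[i], (exists j, c j != 0)
                       & fun_divisor (lin_comb s c) G (E - D)]].

Definition riemann_bound (g : nat) : Prop :=
  forall D (r : nat), r%:Z <= deg D + 1 - g%:Z -> ell_ge D r.

(* The genus is the least g with l(D) >= deg D + 1 - g for all D. *)
Definition has_genus (g : nat) : Prop :=
  riemann_bound g /\ forall g', riemann_bound g' -> (g <= g')%N.

Definition weierstrass_semigroup P : set nat :=
  [set m | m = 0%N \/ base_point_free (complete_linear_system << m%:Z *g P >>)].

Definition weierstrass_point P : Prop :=
  exists2 g, has_genus g
    & ~` weierstrass_semigroup P <> [set m : nat | (1 <= m <= g)%N].

End Divisors.

Definition semigroup_gen2 (a b : nat) : set nat :=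
  [set m | exists i j : nat, m = (i * a + j * b)%N].

(* Main.v *)
(** By the symmetry of <a;b>, m is a gap at the Weierstrass point P if and only
    if 2g-1-m is not. Hence no function has a simple pole at some Q <> P and, off
    Q, only a pole of order at most 2g-2 at P: this takes the place of duality.
    Together with the Riemann inequality it shows that the functions x and y, of
    pole orders a and b at P, separate points and tangents off P.

    Given a g^1_a, take the quotient f of two of its sections with a pole of order
    e >= 1 at P. If f had a further pole Q, a product of at most a-e-1 functions
    with poles of order at most b at P would cancel all its poles off P, up to a
    simple one at Q. As (a-e-1)b+e <= 2g-2 amounts to e+a+1 <= eb, which holds
    for b >= a+2, this is impossible. So P is the only pole of f, hence e = a,
    f is an affine function of x, and the pencil is the one spanned by 1 and x.

    Principal divisors have degree 0, since multiplication by the powers of a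
    function with a divisor of nonzero degree would force g = 0. They are finite
    because the zeros of a uniformizer are isolated and the curve is
    quasi-compact, by Hilbert's basis theorem. *)

From HB Require Import structures.
From mathcomp Require Import all_boot all_order all_algebra.
From mathcomp Require Import generic_quotient ring_quotient fraction.
From mathcomp Require Import boolp classical_sets reals.
From mathcomp.real_closed Require Import complex.
From mathcomp Require Import mpoly freeg zify ring lra.
Require Import Defs.

Set Implicit Arguments.
Unset Strict Implicit.
Unset Printing Implicit Defensive.

Import Order.TTheory GRing.Theory Num.Theory.

Local Open Scope ring_scope.

(** * Numerical semigroups with two generators *)

Section Semigroup.
Variables a b : nat.
Hypotheses (a_gt0 : (0 < a)%N) (b_gt0 : (0 < b)%N) (coprime_ab : coprime a b).

(** Otherwise (i+1)a + (j+1)b = ab, so b divides i+1 by coprimality, and (i+1)a alone is already at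
    least ab. *)
Lemma gen2_frobenius m : (m + a + b = a * b)%N -> ~ semigroup_gen2 a b m.
Proof.
move=> e [i [j em]].
have e1 : (i.+1 * a + j.+1 * b = a * b)%N by lia.
have : (b %| i.+1 * a)%N.
  by rewrite -(dvdn_addl _ (dvdn_mull j.+1 (dvdnn b))) e1 dvdn_mull.
rewrite Gauss_dvdl; last by rewrite coprime_sym.
move=> /(dvdn_leq (ltn0Sn i)) h.
have : (b * a <= i.+1 * a)%N by rewrite leq_mul2r h orbT.
nia.
Qed.

Lemma gen2_symmetric m :
  semigroup_gen2 a b m \/ exists2 n, semigroup_gen2 a b n & (n + m + a + b = a * b)%N.
Proof.
case: (egcdnP b a_gt0) => u w e1 _; move: e1.
have -> : gcdn a b = 1%N by apply/eqP.
move=> e1.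
(* Since [u] inverts a modulo b, this residue i satisfies ia = m modulo b; the sign of m - ia
   decides between the two cases. *)
have ltib : ((u * m) %% b < b)%N by rewrite ltn_mod.
have : ((u * m) %% b * a = m %[mod b])%N.
  rewrite modnMml (_ : (u * m * a = w * m * b + m)%N) ?modnMDl //.
  by rewrite mulnAC e1 mulnDl mul1n; congr (_ + _)%N; rewrite mulnAC.
move: ltib; set i := ((u * m) %% b)%N => ltib emod.
have [leim|ltmi] := leqP (i * a) m.
  left; exists i, ((m - i * a) %/ b)%N.
  rewrite divnK ?subnKC //.
  by rewrite -(eqn_mod_dvd _ leim) emod.
(* If ia - m = (t+1)b, then ab - a - b - m = (b-1-i)a + tb. *)
right; exists ((b - i.+1) * a + ((i * a - m) %/ b).-1 * b)%N.
  by exists (b - i.+1)%N, ((i * a - m) %/ b).-1.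
have : ((i * a - m) %/ b * b = i * a - m)%N.
  by rewrite divnK // -eqn_mod_dvd 1?ltnW // emod.
case: (_ %/ b)%N => [|t] /=; first by lia.
move=> e2.
have : ((b - i.+1) * a + i.+1 * a = a * b)%N by rewrite -mulnDl subnK // mulnC.
lia.
Qed.

End Semigroup.

(** * Divisors and valued function fields *)

Section EffectiveDivisors.
Variable pt : choiceType.
Implicit Types D E : {freeg pt / int}.

Lemma deg_sum D : deg D = \sum_(Q <- dom D) coeff Q D.
Proof.
rewrite -{1}(freeg_sumE D) raddf_sum /=.
by apply: eq_bigr => Q _; rewrite degU.
Qed.

Lemma deg_ge0 D : (forall Q, 0 <= coeff Q D) -> 0 <= deg D.
Proof. by move=> D_ge0; rewrite deg_sum sumr_ge0. Qed.

Lemma deg_gt0_point D : 0 < deg D -> exists Q, 0 < coeff Q D.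
Proof.
move=> D_gt0; apply: contrapT => noQ.
suff: deg D <= 0 by rewrite leNgt D_gt0.
rewrite deg_sum; elim/big_ind: _ => [//|x y x0 y0|Q _]; first by lia.
by rewrite leNgt; apply/negP => D_Q; apply: noQ; exists Q.
Qed.

Lemma coeffU1 (n : int) (P Q : pt) : coeff Q << n *g P >> = n *+ (Q == P).
Proof. by rewrite coeffU eq_sym; case: eqP => _; rewrite ?mulr1 ?mulr0. Qed.

Lemma finite_support_divisor (k : pt -> int) (s : seq pt) :
  (forall P, k P != 0 -> P \in s) ->
  exists D : {freeg pt / int}, forall P, coeff P D = k P.
Proof.
move=> ks; exists (\sum_(Q <- undup s) << k Q *g Q >>) => P.
rewrite raddf_sum /=; under eq_bigr do rewrite coeffU1.
have [Ps|Ps] := boolP (P \in s).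
  rewrite (bigD1_seq P) ?mem_undup ?undup_uniq //= eqxx mulr1n big1 ?addr0 //.
  by move=> Q /negPf QP; rewrite eq_sym QP.
rewrite big_seq big1 => [|Q].
  by apply/esym/eqP; apply: contraNT Ps => /ks.
by rewrite mem_undup; case: eqP => // <-; rewrite (negPf Ps).
Qed.

End EffectiveDivisors.

Section FunctionField.
Variables (k K : fieldType) (iota : {rmorphism k -> K}) (pt : choiceType).
Variable v : pt -> K -> int.
Implicit Types (P Q : pt) (f h : K) (D E : {freeg pt / int}).

(** The zero function has order at least every n, so the value of [v Q 0] never matters. *)
Definition vge Q f (n : int) : bool := (f == 0) || (n <= v Q f).

(** What the argument takes from a curve: valuations trivial on the constants, with residue field
    [k] ([ff_res]), and finitely many zeros and poles for each nonzero function ([ff_div]). *)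
Record function_field : Prop := FunctionField {
  ff_M : forall Q f h, f != 0 -> h != 0 -> v Q (f * h) = v Q f + v Q h;
  ff_D : forall Q f h n, vge Q f n -> vge Q h n -> vge Q (f + h) n;
  ff_C : forall Q c, c != 0 -> v Q (iota c) = 0;
  ff_res : forall Q f, f != 0 -> v Q f = 0 -> exists c, vge Q (f - iota c) 1;
  ff_div : forall f, f != 0 -> exists D, forall Q, coeff Q D = v Q f }.

(** The Riemann-Roch space L(D). *)
Definition inL D f : Prop := forall Q, vge Q f (- coeff Q D).

Definition comb r (s : 'I_r -> K) (c : 'I_r -> k) : K :=
  \sum_(j < r) iota (c j) * s j.

(** Linear independence and membership in L(D) in a single condition, as in
    [independent_sections]. *)
Definition indep D r (s : 'I_r -> K) : Prop :=
  forall c : 'I_r -> k, (exists j, c j != 0) -> comb s c != 0 /\ inL D (comb s c).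

Definition riemann (g : nat) : Prop :=
  forall D r, r%:Z <= deg D + 1 - g%:Z -> exists s : 'I_r -> K, indep D s.

Hypothesis ffK : function_field.

Lemma vge0 Q n : vge Q 0 n. Proof. by rewrite /vge eqxx. Qed.

Lemma vge_le Q f m n : m <= n -> vge Q f n -> vge Q f m.
Proof.
by rewrite /vge => mn; case/orP=> [->|/(le_trans mn) ->]; rewrite ?orbT.
Qed.

Lemma vgeE Q f n : f != 0 -> vge Q f n = (n <= v Q f).
Proof. by rewrite /vge => /negPf ->. Qed.

Lemma vgeM Q f h m n : vge Q f m -> vge Q h n -> vge Q (f * h) (m + n).
Proof.
have [->|f0] := eqVneq f 0; first by rewrite mul0r !vge0.
have [->|h0] := eqVneq h 0; first by rewrite mulr0 !vge0.
by rewrite !vgeE ?mulf_neq0 // (ff_M ffK) //; apply: lerD.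
Qed.

Lemma vgeC Q c : vge Q (iota c) 0.
Proof.
have [->|c0] := eqVneq c 0; first by rewrite rmorph0 vge0.
by rewrite /vge (ff_C ffK) // lexx orbT.
Qed.

Lemma vgeZ Q c f n : vge Q f n -> vge Q (iota c * f) n.
Proof. by move=> /(vgeM (vgeC Q c)); rewrite add0r. Qed.

Lemma vgeN Q f n : vge Q f n -> vge Q (- f) n.
Proof. by move=> /(vgeZ (-1)); rewrite rmorphN rmorph1 mulN1r. Qed.

Lemma vgeB Q f h n : vge Q f n -> vge Q h n -> vge Q (f - h) n.
Proof. by move=> ? /vgeN; apply: (ff_D ffK). Qed.

Lemma vge_eq Q f n : vge Q f n -> ~~ vge Q f (n + 1) -> f != 0 /\ v Q f = n.
Proof.
have [->|f0] := eqVneq f 0; first by rewrite !vge0.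
rewrite !vgeE //; split=> //; lia.
Qed.

Lemma v1 Q : v Q 1 = 0.
Proof. by rewrite -(rmorph1 iota) (ff_C ffK) ?oner_neq0. Qed.

Lemma vV Q f : f != 0 -> v Q f^-1 = - v Q f.
Proof.
move=> f0; apply/eqP; rewrite -addr_eq0 -(ff_M ffK) ?invr_eq0 //.
by rewrite mulVf ?v1.
Qed.

Lemma vX Q f n : f != 0 -> v Q (f ^+ n) = v Q f *+ n.
Proof.
move=> f0; elim: n => [|n IH]; first by rewrite expr0 v1.
by rewrite exprS (ff_M ffK) ?expf_neq0 // IH mulrS.
Qed.

(** The quotient f / h is a unit at Q, and [c] is its residue. *)
Lemma cancel_leading Q f h : f != 0 -> h != 0 -> v Q f = v Q h ->
  exists c, vge Q (f - iota c * h) (v Q f + 1).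
Proof.
move=> f0 h0 e.
have [||c] := ff_res ffK (Q := Q) (f := f / h).
- by rewrite mulf_neq0 ?invr_eq0.
- by rewrite (ff_M ffK) ?invr_eq0 ?vV // e subrr.
move=> hc; exists c.
have -> : f - iota c * h = h * (f / h - iota c) by field.
by apply: vgeM => //; rewrite vgeE // e.
Qed.

Lemma inL0 D : inL D 0. Proof. by move=> Q; rewrite vge0. Qed.

Lemma inLD D f h : inL D f -> inL D h -> inL D (f + h).
Proof. by move=> Df Dh Q; apply: (ff_D ffK). Qed.

Lemma inLB D f h : inL D f -> inL D h -> inL D (f - h).
Proof. by move=> Df Dh Q; apply: vgeB. Qed.

Lemma inLZ D c f : inL D f -> inL D (iota c * f).
Proof. by move=> Df Q; apply: vgeZ. Qed.

Lemma inLM D E f h : inL D f -> inL E h -> inL (D + E) (f * h).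
Proof. by move=> Df Eh Q; rewrite coeffD opprD; apply: vgeM. Qed.

Lemma inL_le D E f : (forall Q, coeff Q D <= coeff Q E) -> inL D f -> inL E f.
Proof. by move=> DE Df Q; apply: vge_le (Df Q); rewrite lerN2. Qed.

Lemma inLC D c : (forall Q, 0 <= coeff Q D) -> inL D (iota c).
Proof. by move=> D0 Q; apply: vge_le (vgeC Q c); rewrite oppr_le0. Qed.

Lemma inL_comb D r (s : 'I_r -> K) c : (forall j, inL D (s j)) -> inL D (comb s c).
Proof.
move=> Ds; rewrite /comb; elim/big_ind: _ => [|x y|j _].
- exact: inL0.
- exact: inLD.
- exact: inLZ.
Qed.

Lemma indep_inL D r (s : 'I_r -> K) j : indep D s -> inL D (s j).
Proof.
move=> /(_ (fun i => (i == j)%:R)) []; first by exists j; rewrite eqxx oner_neq0.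
rewrite /comb (bigD1 j) //= eqxx rmorph1 mul1r big1 ?addr0 //.
by move=> i /negPf ->; rewrite rmorph0 mul0r.
Qed.

(** * Principal divisors have degree zero *)

Section Genus.
Variable g : nat.
Hypotheses (g_gt0 : (0 < g)%N) (riemann_g : riemann g).
Hypothesis g_min : forall g', riemann g' -> (g <= g')%N.

Lemma deg_principal_le0 f E : f != 0 -> (forall Q, coeff Q E = v Q f) -> deg E <= 0.
Proof.
move=> f0 Ef; rewrite leNgt; apply/negP => E0.
suff /g_min : riemann 0 by rewrite leqNgt g_gt0.
(* For this [N], Riemann's inequality gives [r] independent functions in L(D + N E), and
   multiplication by [f ^+ N] moves them into L(D). So l(D) >= r for all [D] and [r], and the bound
   holds with 0 in place of g. *)
move=> D r _; pose N := (r + g + `|deg D|)%N.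
have [|s sP] := riemann_g (D := D + E *+ N) (r := r).
  have : N%:Z <= deg E *+ N by rewrite -mulr_natr natz; nia.
  by rewrite degD degMn /N; lia.
exists (fun j => f ^+ N * s j) => c c0.
have -> : comb (fun j => f ^+ N * s j) c = f ^+ N * comb s c.
  by rewrite /comb big_distrr /=; apply: eq_bigr => j _; rewrite mulrCA.
have [s0 sD] := sP c c0; split; first by rewrite mulf_neq0 ?expf_neq0.
move=> Q; have := sD Q; rewrite coeffD coeffMn Ef !vgeE ?mulf_neq0 ?expf_neq0 //.
rewrite (ff_M ffK) ?expf_neq0 // vX //; lia.
Qed.

(* Were the divisor [E] of [f] of nonzero degree, multiplication by powers of
   [f] would move any L(D) into arbitrarily large degree, and the genus would
   be 0. *)
Lemma deg_principal f E : f != 0 -> (forall Q, coeff Q E = v Q f) -> deg E = 0.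
Proof.
move=> f0 Ef; apply/eqP; rewrite eq_le (deg_principal_le0 f0 Ef) /=.
rewrite -oppr_le0 -degN; apply: (@deg_principal_le0 f^-1).
  by rewrite invr_eq0.
by move=> Q; rewrite coeffN Ef vV.
Qed.

Lemma inL_deg_lt0 D f : deg D < 0 -> inL D f -> f = 0.
Proof.
move=> D0 Df; apply/eqP; apply: contraT => f0.
have [E Ef] := ff_div ffK f0.
have := deg_principal f0 Ef.
suff : 0 <= deg (D + E) by rewrite degD; lia.
apply: deg_ge0 => Q; rewrite coeffD Ef; have := Df Q; rewrite vgeE //; lia.
Qed.


(** * Functions whose only pole is the Weierstrass point *)

Variables (P : pt) (a b : nat).
Hypotheses (a_gt1 : (1 < a)%N) (ab : (a + 1 < b)%N) (coprime_ab : coprime a b).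
Hypothesis g_ab : (2 * g = (a - 1) * (b - 1))%N.
Local Notation mP m := << (m : int) *g P >>.
Hypothesis semigroup_P : forall m : nat, semigroup_gen2 a b m <->
  (m = 0%N \/ forall Q, exists f,
     [/\ f != 0, inL (mP m) f & v Q f = - coeff Q (mP m)]).

(** The largest gap ab - a - b is thus 2g - 1. *)
Lemma ab_g : (2 * g + a + b = a * b + 1)%N.
Proof. rewrite g_ab; nia. Qed.

Lemma inL_drop D Q f : inL D f -> vge Q f (1 - coeff Q D) -> inL (D - << Q >>) f.
Proof.
move=> Df Qf R; rewrite coeffB coeffU1; have [->|_] := eqVneq R Q.
  by rewrite mulr1n opprB.
by rewrite mulr0n subr0.
Qed.

(** A function [t] with the largest pole that D allows at Q cancels the leading term of any other:
    this is l(D) <= l(D - Q) + 1 in explicit form. *)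
Lemma reduce_at D Q f t : inL D f -> inL D t -> t != 0 -> v Q t = - coeff Q D ->
  exists c, inL (D - << Q >>) (f - iota c * t).
Proof.
move=> Df Dt t0 vt.
have [f1|f1] := boolP (vge Q f (- coeff Q D + 1)).
  exists 0; rewrite rmorph0 mul0r subr0; apply: inL_drop => //.
  by rewrite addrC.
have [f0 vf] := vge_eq (Df Q) f1.
have [|c hc] := @cancel_leading Q f t f0 t0; first by rewrite vf vt.
exists c; apply: inL_drop; first by apply: inLB => //; apply: inLZ.
by rewrite [1 - _]addrC -vf.
Qed.

Lemma evaluate Q f : vge Q f 0 -> exists c, vge Q (f - iota c) 1.
Proof.
move=> f0; have [f1|f1] := boolP (vge Q f 1).
  by exists 0; rewrite rmorph0 subr0.
by have [] := vge_eq f0 f1; apply: (ff_res ffK).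
Qed.

Lemma v_addl Q f h : f != 0 -> vge Q h (v Q f + 1) ->
  f + h != 0 /\ v Q (f + h) = v Q f.
Proof.
move=> f0 h1; apply: vge_eq.
  apply: (ff_D ffK); first by rewrite vgeE.
  by apply: vge_le h1; lia.
apply/negP => /vgeB /(_ h1); rewrite addrK vgeE //; lia.
Qed.

Lemma coeffmP (m : int) : coeff P (mP m) = m.
Proof. by rewrite coeffU1 eqxx. Qed.

Lemma coeffmP_neq Q (m : int) : Q != P -> coeff Q (mP m) = 0.
Proof. by rewrite coeffU1 => /negPf ->. Qed.

(** One function with a pole of order exactly m is enough for |mP| to be base point free: the
    constant 1 takes care of the points other than P. *)
Lemma order_gen2 (m : nat) f : f != 0 -> inL (mP m) f -> v P f = - m%:Z ->
  semigroup_gen2 a b m.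
Proof.
move=> f0 mf vf; apply/semigroup_P; right => Q.
have [->|QP] := eqVneq Q P; first by exists f; rewrite coeffmP.
exists 1; split; first exact: oner_neq0.
  rewrite -(rmorph1 iota); apply: inLC => R; rewrite coeffU1; lia.
by rewrite coeffmP_neq // v1.
Qed.

Lemma gen2_order (m : nat) : semigroup_gen2 a b m ->
  exists f, [/\ f != 0, inL (mP m) f & v P f = - m%:Z].
Proof.
move/semigroup_P => [->|/(_ P) [f [f0 mf vf]]].
  exists 1; split; rewrite ?v1 ?oner_neq0 //.
  rewrite -(rmorph1 iota); apply: inLC => R; rewrite coeffU1; lia.
by exists f; split=> //; rewrite vf coeffmP.
Qed.

(** Subtracting the value at P leaves an element of L(-P), which is 0 as -P has negative degree. *)
Lemma inL_const f : inL (mP 0) f -> exists c, f = iota c.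
Proof.
move=> f0; have [|c hc] := @evaluate P f.
  by have := f0 P; rewrite coeffmP oppr0.
exists c; apply/eqP; rewrite -subr_eq0; apply/eqP.
apply: (inL_deg_lt0 (D := mP 0 - << P >>)) => //.
  by rewrite degB !degU.
apply: inL_drop; last by rewrite coeffmP.
apply: inLB => //; apply: inLC => Q; rewrite coeffU1; lia.
Qed.

Lemma mP_pred (m : int) : mP m - << P >> = mP (m - 1).
Proof. by rewrite freegUB. Qed.

Lemma gap_drop (m : nat) f : ~ semigroup_gen2 a b m -> inL (mP m) f ->
  inL (mP (m%:Z - 1)) f.
Proof.
move=> gap mf; rewrite -mP_pred; apply: inL_drop => //.
apply: contraT; rewrite coeffmP addrC => f1.
have := mf P; rewrite coeffmP => /vge_eq /(_ f1) [f0 vf].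
by case: gap; apply: order_gen2 f0 mf vf.
Qed.

Lemma gen2_ltn_a m : semigroup_gen2 a b m -> (m < a)%N -> m = 0%N.
Proof.
case=> [[|i]] [[|j] ->] //; rewrite ?mul0n ?add0n ?addn0 ?mulSn; lia.
Qed.

Lemma inL_ltn_a (m : nat) f : (m < a)%N -> inL (mP m) f -> exists c, f = iota c.
Proof.
elim: m f => [|m IH] f ma mf; first exact: inL_const.
apply: IH; first exact: ltnW.
have -> : m%:Z = m.+1%:Z - 1 by lia.
by apply: gap_drop mf => /gen2_ltn_a /(_ ma).
Qed.

Lemma coordinate_x : exists x, [/\ x != 0, inL (mP a) x & v P x = - a%:Z].
Proof. by apply: gen2_order; exists 1%N, 0%N; rewrite mul1n mul0n addn0. Qed.

Lemma coordinate_y : exists y, [/\ y != 0, inL (mP b) y & v P y = - b%:Z].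
Proof. by apply: gen2_order; exists 0%N, 1%N; rewrite mul1n mul0n add0n. Qed.

Lemma inL_mPX (m n : nat) f : inL (mP m) f -> inL (mP (n * m)%N) (f ^+ n).
Proof.
move=> mf; elim: n => [|n IH].
  rewrite expr0 -(rmorph1 iota); apply: inLC => R; rewrite coeffU1; lia.
rewrite exprS mulSn PoszD -freegUD; exact: inLM.
Qed.

Section Coordinates.
Variables x y : K.
Hypotheses (x_neq0 : x != 0) (x_in : inL (mP a) x) (vx : v P x = - a%:Z).
Hypotheses (y_neq0 : y != 0) (y_in : inL (mP b) y) (vy : v P y = - b%:Z).

(* The functions regular off [P] form the ring generated by [x] and [y]. *)
Lemma polynomial_ind (B : K -> Prop) :
  (forall c, B (iota c)) -> (forall f h, B f -> B h -> B (f + h)) ->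
  (forall f h, B f -> B h -> B (f * h)) -> B x -> B y ->
  forall (m : nat) f, inL (mP m) f -> B f.
Proof.
move=> BC BD BM Bx By.
have BX z n : B z -> B (z ^+ n).
  move=> Bz; elim: n => [|n IH]; first by rewrite expr0 -(rmorph1 iota).
  by rewrite exprS; apply: BM.
elim=> [|m IH] f mf; first by have [c ->] := inL_const mf.
have em : m%:Z = m.+1%:Z - 1 by lia.
have [[i [j e]]|gap] := pselect (semigroup_gen2 a b m.+1); last first.
  by apply: IH; rewrite em; apply: gap_drop.
(* This monomial has a pole of order exactly m+1 = ia + jb at P, so a multiple of it brings [f] down
   to L(mP). *)
pose t := x ^+ i * y ^+ j.
have mt : inL (mP m.+1) t by rewrite e PoszD -freegUD; apply: inLM; apply: inL_mPX.
have [||c] := reduce_at (Q := P) mf mt.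
- by rewrite mulf_neq0 ?expf_neq0.
- rewrite coeffmP (ff_M ffK) ?expf_neq0 // !vX // vx vy e PoszD !PoszM; lia.
rewrite mP_pred -em => /IH Bf.
rewrite -(subrK (iota c * t) f); apply: BD => //.
by apply: (BM) => //; apply: (BM); apply: (BX).
Qed.

End Coordinates.

(** * The dimension of L(MP), and simple poles off P *)

Definition nongaps (M : nat) : nat := \sum_(j < M.+1) `[< semigroup_gen2 a b j >].

(** L((M+1)P) exceeds L(MP) by at most one dimension, and only if M+1 is not a gap. The family is
    indexed by [nat] so that a member can be appended without a change of type. *)
Lemma inL_span (M : nat) : exists t : nat -> K, forall f, inL (mP M) f ->
  exists c : nat -> k, f = \sum_(j < nongaps M) iota (c j) * t j.
Proof.
elim: M => [|M [t IH]].
  exists (fun=> 1) => f /inL_const [c ->]; exists (fun=> c).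
  rewrite /nongaps big_ord1 asboolT; last by exists 0%N, 0%N.
  by rewrite big_ord1 mulr1.
have eM : M%:Z = M.+1%:Z - 1 by lia.
have [gM|gap] := pselect (semigroup_gen2 a b M.+1); last first.
  exists t => f /(gap_drop gap); rewrite -eM => /IH [c ->]; exists c.
  by rewrite /nongaps [in RHS]big_ord_recr /= (asboolF gap) addn0.
have [t' [t'0 t'M vt']] := gen2_order gM.
pose N := nongaps M.
have eN : nongaps M.+1 = N.+1.
  by rewrite /nongaps big_ord_recr /= (asboolT gM) addn1.
exists (fun j => if (j < N)%N then t j else t') => f fM.
have [|c] := reduce_at (Q := P) fM t'M t'0; first by rewrite coeffmP.
rewrite mP_pred -eM => /IH [d ed].
exists (fun j => if (j < N)%N then d j else c).
rewrite eN big_ord_recr /= ltnn -(subrK (iota c * t') f) ed; congr (_ + _).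
by apply: eq_bigr => j _ /=; rewrite ltn_ord.
Qed.

(** With more functions than [nongaps M], their matrix over the spanning family would have more rows
    than columns; a nonzero vector of its left kernel is a vanishing combination. *)
Lemma indep_leq r (M : nat) (s : 'I_r -> K) : indep (mP M) s -> (r <= nongaps M)%N.
Proof.
move=> sM; have [t tP] := inL_span M; set N := nongaps M in tP *.
have /choice [A sA] : forall i, exists c : nat -> k,
    s i = \sum_(j < N) iota (c j) * t j.
  by move=> i; apply: tP; apply: indep_inL sM.
rewrite leqNgt; apply/negP => Nr.
pose B : 'M_(r, N) := \matrix_(i, j) A i j.
have : kermx B != 0.
  rewrite -mxrank_eq0 mxrank_ker subn_eq0 -ltnNge.
  exact: leq_ltn_trans (rank_leq_col B) Nr.
case/rowV0Pn => c /sub_kermxP cB c0.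
have [j cj] : exists j, c 0 j != 0.
  by have /rV0Pn := c0.
have [|/eqP []] := sM (c 0); first by exists j.
rewrite /comb; under eq_bigr do rewrite sA big_distrr /=.
rewrite exchange_big big1 //= => l _.
under eq_bigr do rewrite mulrA -rmorphM.
rewrite -big_distrl -rmorph_sum /=.
have -> : \sum_(i < r) c 0 i * A i l = 0.
  have /rowP /(_ l) := cB; rewrite !mxE; apply: etrans.
  by apply: eq_bigr => i _; rewrite mxE.
by rewrite rmorph0 mul0r.
Qed.

(** Their sum would put 2g - 1, the largest gap, in the semigroup. *)
Lemma not_gen2_pair i j : (i + j + 1 = 2 * g)%N ->
  semigroup_gen2 a b i -> semigroup_gen2 a b j -> False.
Proof.
move=> e [i1 [i2 ei]] [j1 [j2 ej]].
have a0 : (0 < a)%N by lia.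
have b0 : (0 < b)%N by lia.
have eF := ab_g.
have gF : semigroup_gen2 a b (i + j).
  by exists (i1 + j1)%N, (i2 + j2)%N; rewrite ei ej !mulnDl; lia.
by case: (@gen2_frobenius a b a0 b0 coprime_ab (i + j)) => //; lia.
Qed.

(** At most one of j and 2g-1-j lies in the semigroup, and summing over all j < 2g counts each
    nongap twice. With [indep_leq], this says that l((2g-1)P) <= g. *)
Lemma nongaps_leq : (nongaps (2 * g).-1 <= g)%N.
Proof.
rewrite /nongaps prednK; last by lia.
set S := (\sum_(_ < _) _)%N.
suff : (S + S <= 2 * g)%N by lia.
rewrite {2}/S (reindex_inj rev_ord_inj) /= -big_split /=.
rewrite -[leqRHS](card_ord (2 * g)) -sum1_card; apply: leq_sum => j _.
case: asboolP => // gj; case: asboolP => // gj'.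
by case: (not_gen2_pair _ gj gj'); have := ltn_ord j; lia.
Qed.

(** Riemann's inequality gives g+1 independent functions in L((2g-1)P + Q), too many for all of them
    to lie in L((2g-1)P). *)
Lemma simple_pole Q : Q != P -> exists u,
  [/\ u != 0, inL (mP (2 * g).-1%N + << Q >>) u & v Q u = -1].
Proof.
move=> QP; set D := _ + _.
have [|s sD] := riemann_g (D := D) (r := g.+1).
  by rewrite degD !degU; lia.
have cD : coeff Q D = 1 by rewrite coeffD coeffmP_neq // coeffU1 eqxx.
have [[j sj]|alls] := pselect (exists j, ~~ vge Q (s j) 0).
  have jD := indep_inL j sD.
  exists (s j); have := jD Q; rewrite cD => /vge_eq /(_ sj) [s0 vs].
  by split.
have : indep (mP (2 * g).-1%N) s.
  move=> c c0; split; first by have [] := sD c c0.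
  apply: inL_comb => j; have := indep_inL j sD => /inL_drop.
  move/(_ Q); rewrite cD subrr addrK; apply.
  by apply/negPn/negP => ?; apply: alls; exists j.
by move/indep_leq/leq_trans/(_ nongaps_leq); rewrite ltnn.
Qed.

(* If [n] is the order of the pole of [f] at [P], reduced to a gap, then the
   symmetry of the semigroup provides [h] with a pole of order 2g-1-n, and
   [f * (h - h(Q))] has only a pole at [P], of order the gap 2g-1. *)
Lemma no_simple_pole Q N f : Q != P -> (N < 2 * g)%N ->
  inL (mP (N%:Z - 1) + << Q >>) f -> f != 0 -> v Q f != -1.
Proof.
move=> QP; have a0 : (0 < a)%N by lia.
have b0 : (0 < b)%N by lia.
have eF := ab_g.
have cPQ : coeff P (<< Q >> : {freeg pt / int}) = 0.
  by rewrite coeffU1 eq_sym (negPf QP).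
have cP (m : int) : coeff P (mP m + << Q >>) = m by rewrite coeffD coeffmP cPQ addr0.
have dropP (m : int) : mP m + << Q >> - << P >> = mP (m - 1) + << Q >>.
  by rewrite addrAC mP_pred.
have nongap (n : nat) f1 : (n < 2 * g)%N -> inL (mP (n%:Z - 1) + << Q >>) f1 ->
    f1 != 0 -> v Q f1 = -1 -> v P f1 = 1 - n%:Z -> ~ semigroup_gen2 a b (2 * g - n)%N.
  move=> ng f1L f10 vQ vP gn; have [h [h0 hL vh]] := gen2_order gn.
  have [c hc] : exists c, vge Q (h - iota c) 1.
    by apply: evaluate; have := hL Q; rewrite coeffmP_neq.
  have [h'0 vh'] : h - iota c != 0 /\ v P (h - iota c) = v P h.
    by apply: v_addl => //; apply/vgeN; apply: vge_le (vgeC P c); rewrite vh; lia.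
  have hcL : inL (mP (2 * g - n)%N - << Q >>) (h - iota c).
    apply: inL_drop; last by rewrite coeffmP_neq // subr0.
    by apply: inLB => //; apply: inLC => R; rewrite coeffU1; lia.
  have := inLM f1L hcL; rewrite addrACA subrr addr0 freegUD => prodL.
  case: (@gen2_frobenius a b a0 b0 coprime_ab (2 * g).-1); first by lia.
  apply: (@order_gen2 _ (f1 * (h - iota c))); first by rewrite mulf_neq0.
    by apply: inL_le prodL => R; rewrite !coeffU1; lia.
  by rewrite (ff_M ffK) // vP vh' vh; lia.
elim: N f => [|N IH] f Ng fL f0; apply/eqP => vf.
  (* For N = 0 the function vanishes at P. A double zero puts it in L(-2P + Q), of negative degree;
     a simple zero is excluded by [nongap], because 2g exceeds the largest gap and so belongs to the
     semigroup. *)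
  have [f1|f1] := boolP (vge P f (1 + 1)).
    have fL' : inL (mP (- 2) + << Q >>) f.
      have -> : -2 = 0%:Z - 1 - 1 by [].
      by rewrite -dropP; apply: inL_drop => //; rewrite cP.
    move/eqP: f0; apply; apply: inL_deg_lt0 fL'; first by rewrite degD !degU.
  have := fL P; rewrite cP => /vge_eq /(_ f1) [_ vP].
  case: (@gen2_symmetric a b a0 b0 coprime_ab (2 * g)) => [|[m _]]; last by lia.
  by have := nongap 0%N f; rewrite subn0; apply.
have [f1|f1] := boolP (vge P f (1 - N%:Z)).
  have fL' : inL (mP (N%:Z - 1) + << Q >>) f.
    have -> : N%:Z = N.+1%:Z - 1 by lia.
    rewrite -dropP; apply: inL_drop => //; rewrite cP.
    by apply: vge_le f1; lia.
  by move/eqP: (IH f (ltnW Ng) fL' f0); apply.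
have vP : v P f = - N%:Z.
  have := fL P; rewrite cP => /vge_eq [|_ ->]; last by lia.
  by apply: contraNN f1; apply: vge_le; lia.
(* The pole at P has order exactly N. If 2g-1-N is a nongap, [nongap] concludes; otherwise N is one,
   and a function with that pole order, regular at Q, lowers the order at P while keeping the simple
   pole at Q. *)
case: (@gen2_symmetric a b a0 b0 coprime_ab (2 * g - N.+1)%N) => [|[n gn en]].
  by apply: nongap fL f0 vf _ => //; rewrite vP; lia.
have en' : n = N by lia.
have [t [t0 tL vt]] := gen2_order gn; rewrite {}en' in gn tL vt *.
have tL' : inL (mP (N.+1%:Z - 1) + << Q >>) t.
  by apply: inL_le tL => R; rewrite coeffD !coeffU1; lia.
have [|c] := reduce_at (Q := P) fL tL' t0.
  by rewrite cP vt; lia.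
rewrite dropP => f'L.
have [f'0 vf'] : f - iota c * t != 0 /\ v Q (f - iota c * t) = v Q f.
  apply: v_addl => //; apply/vgeN/vgeZ; rewrite vf.
  by have := tL Q; rewrite coeffmP_neq.
suff : v Q (f - iota c * t) != -1 by rewrite vf' vf.
apply: IH => //; first exact: ltnW.
by apply: inL_le f'L => R; rewrite !coeffD !coeffU1; lia.
Qed.

(** Separation of the points Q1 and Q, or of tangents if Q1 = Q, with a pole of order at most b. If
    neither x nor y achieved it, every function regular off P, being a polynomial in them, would be
    constant modulo Q1 + Q; but some function with a possibly larger pole at P is not. *)
Lemma separating_function Q1 Q : Q1 != P -> Q != P -> exists h,
  [/\ h != 0, inL (mP b - << Q1 >>) h & v Q h = (Q1 == Q)%:Z].
Proof.
move=> Q1P QP; set d := (Q1 == Q)%:Z.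
have cQ m : coeff Q (mP m - << Q1 >>) = - d.
  by rewrite coeffB coeffmP_neq // coeffU1 /d eq_sym; case: eqP.
have cQQ m : coeff Q (mP m - << Q1 >> - << Q >>) = - d - 1.
  by rewrite coeffB cQ coeffU1 eqxx.
have cQ1 m : coeff Q1 (mP m - << Q1 >>) = -1.
  by rewrite coeffB coeffmP_neq // coeffU1 eqxx.
have cQQ1 m : coeff Q1 (mP m - << Q1 >> - << Q >>) = -1 - d.
  by rewrite coeffB cQ1 coeffU1 /d; case: eqP.
have le_mP (m n : nat) f : (m <= n)%N ->
    inL (mP m - << Q1 >> - << Q >>) f -> inL (mP n - << Q1 >> - << Q >>) f.
  by move=> mn; apply: inL_le => R; rewrite !coeffB !coeffU1; lia.
have [x [x0 xP vx]] := coordinate_x; have [y [y0 yP vy]] := coordinate_y.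
(* First without a bound on the pole at P: starting from x - x(Q1), each multiplication by a
   function [u] with a simple pole at Q lowers the order at Q by one, until it equals [d]. *)
have [m [h [h0 hm vh]]] : exists (m : nat) h,
    [/\ h != 0, inL (mP m - << Q1 >>) h & v Q h = d].
  have [c hc] : exists c, vge Q1 (x - iota c) 1.
    by apply: evaluate; have := xP Q1; rewrite coeffmP_neq.
  have [x'0 vx'] : x - iota c != 0 /\ v P (x - iota c) = v P x.
    by apply: v_addl => //; apply/vgeN; apply: vge_le (vgeC P c); rewrite vx; lia.
  have x'm : inL (mP a - << Q1 >>) (x - iota c).
    apply: inL_drop; last by rewrite coeffmP_neq // subr0.
    by apply: inLB => //; apply: inLC => R; rewrite coeffU1; lia.
  have : exists n : nat, v Q (x - iota c) = n%:Z + d.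
    have := x'm Q; rewrite cQ opprK vgeE // => dv.
    by exists `|v Q (x - iota c) - d|%N; lia.
  have [u [u0 uL vu]] := simple_pole QP.
  case=> n; move: x'0 x'm; move: (x - iota c) => h h0 hm; clear vx' hc c.
  elim: n a h h0 hm => [|n IH] m h h0 hm vh.
    by exists m, h; rewrite vh add0r.
  apply: (IH (m + (2 * g).-1)%N (h * u)).
  - by rewrite mulf_neq0.
  - have := inLM hm uL; set D := _ + (_ + _) => hu.
    have -> : mP (m + (2 * g).-1)%N - << Q1 >> = D - << Q >>.
      by rewrite /D PoszD -freegUD addrACA [in RHS]addrA addrK addrAC.
    apply: inL_drop => //.
    have -> : coeff Q D = 1 - d.
      by rewrite /D coeffD cQ coeffD coeffmP_neq // coeffU1 eqxx addrC.
    rewrite vgeE ?mulf_neq0 // (ff_M ffK) // vh vu; lia.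
  - rewrite (ff_M ffK) // vh vu; lia.
(* The functions congruent to a constant modulo Q1 + Q, with any pole at P. They form a ring, to
   which [polynomial_ind] applies. *)
pose B f := exists c (m : nat), inL (mP m - << Q1 >> - << Q >>) (f - iota c).
have finish z : inL (mP b) z -> ~ B z -> exists h,
    [/\ h != 0, inL (mP b - << Q1 >>) h & v Q h = d].
  move=> zb nBz; have [c hc] : exists c, vge Q1 (z - iota c) 1.
    by apply: evaluate; have := zb Q1; rewrite coeffmP_neq.
  have z'b : inL (mP b - << Q1 >>) (z - iota c).
    apply: inL_drop; last by rewrite coeffmP_neq // subr0.
    by apply: inLB => //; apply: inLC => R; rewrite coeffU1; lia.
  have /vge_eq [] : vge Q (z - iota c) d by have := z'b Q; rewrite cQ opprK.
    apply/negP => z'1; apply: nBz; exists c, b; apply: inL_drop => //.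
    by rewrite cQ opprK [1 + _]addrC.
  by exists (z - iota c).
have [Bx|nBx] := pselect (B x); last first.
  apply: finish nBx; apply: inL_le xP => R; rewrite !coeffU1; lia.
have [By|nBy] := pselect (B y); last exact: finish nBy.
have [c [n hc]] : B h.
  have hm' : inL (mP m) h.
    by apply: inL_le hm => R; rewrite coeffB !coeffU1; lia.
  apply: (polynomial_ind x0 xP vx y0 yP) hm' => // [c|f f'|f f'].
  - by exists c, 0%N; rewrite subrr; apply: inL0.
  - case=> [c [n hc]] [c' [n' hc']]; exists (c + c'), (n + n')%N.
    rewrite rmorphD opprD addrACA.
    by apply: inLD; [apply: le_mP hc | apply: le_mP hc']; lia.
  - case=> [c [n hc]] [c' [n' hc']]; exists (c * c'), (n + n')%N.
    have -> : f * f' - iota (c * c') = (f - iota c) * (f' - iota c')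
        + iota c * (f' - iota c') + iota c' * (f - iota c).
      by rewrite rmorphM; ring.
    apply: inLD; first apply: inLD.
    + apply: inL_le (inLM hc hc') => R.
      rewrite !(coeffB, coeffD, coeffU1); lia.
    + by apply/inLZ/(le_mP _ _ _ _ hc'); lia.
    + by apply/inLZ/(le_mP _ _ _ _ hc); lia.
have d01 : 0 <= d by [].
(* The constant is h(Q1) = 0, so [hc] gives h an order above [d] at Q. *)
have c0 : c = 0.
  apply/eqP; apply: contraT => c0.
  have h1 : vge Q1 h 1 by have := hm Q1; rewrite cQ1 opprK.
  have h2 : vge Q1 (h - iota c) 1 by apply: vge_le (hc Q1); rewrite cQQ1; lia.
  by have := vgeB h1 h2; rewrite subKr vgeE ?fmorph_eq0 // (ff_C ffK).
have := hc Q; rewrite c0 rmorph0 subr0 cQQ vgeE // vh; lia.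
Qed.

(** A product of separating functions, one for each point of E with multiplicity; each contributes
    to the order at Q exactly as much as its point does. *)
Lemma vanishing_function Q E n : Q != P -> (forall R, 0 <= coeff R E) ->
  coeff P E = 0 -> deg E = n%:Z ->
  exists h, [/\ h != 0, inL (mP (n * b)%N - E) h & v Q h = coeff Q E].
Proof.
move=> QP; elim: n E => [|n IH] E E0 EP dE.
  have -> : E = 0 by apply: fgpos_eq0P => //; apply/fgposP.
  exists 1; rewrite oner_neq0 v1 coeff0; split=> //.
  by rewrite subr0 -(rmorph1 iota); apply: inLC => R; rewrite coeffU1; lia.
have [|Q1 EQ1] := @deg_gt0_point _ E; first by rewrite dE.
have Q1P : Q1 != P by apply: contraTneq EQ1 => ->; rewrite EP.
have [|||h [h0 hL vh]] := IH (E - << Q1 >>).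
- move=> R; rewrite coeffB coeffU1; have := E0 R.
  have [->|_] := eqVneq R Q1; lia.
- by rewrite coeffB EP coeffU1 eq_sym (negPf Q1P).
- by rewrite degB dE degU; lia.
have [h' [h'0 h'L vh']] := separating_function Q1P QP.
exists (h' * h); split; first by rewrite mulf_neq0.
  have := inLM h'L hL; congr inL.
  by rewrite mulSn PoszD -freegUD opprB addrACA addKr.
rewrite (ff_M ffK) // vh vh' coeffB coeffU1 (eq_sym Q).
case: eqP => _; lia.
Qed.

(** Points Q are removed from E one at a time. If f had at Q the whole pole allowed by E, its
    product with a function vanishing along E - Q, with a pole of order at most (deg E - 1)b at P,
    would have the simple pole that [no_simple_pole] forbids. *)
Lemma inL_add_point_off_P E e f : (0 < e)%N -> (forall R, 0 <= coeff R E) ->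
  coeff P E = 0 -> deg E + e%:Z <= a%:Z -> inL (mP e + E) f -> inL (mP e) f.
Proof.
move=> e0 E0 EP; have := deg_ge0 E0.
case eE : (deg E) => [n|//] _.
elim: n E E0 EP eE => [|n IH] E E0 EP dE na fL.
  suff E00 : E = 0 by rewrite E00 addr0 in fL.
  by apply: fgpos_eq0P => //; apply/fgposP.
have [|Q EQ] := @deg_gt0_point _ E; first by rewrite dE.
have QP : Q != P by apply: contraTneq EQ => ->; rewrite EP.
pose E' := E - << Q >>.
have E'0 R : 0 <= coeff R E'.
  rewrite coeffB coeffU1; have := E0 R.
  have [->|_] := eqVneq R Q; lia.
have E'P : coeff P E' = 0 by rewrite coeffB EP coeffU1 eq_sym (negPf QP).
have dE' : deg E' = n by rewrite degB dE degU; lia.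
have cQ : coeff Q (mP e + E) = coeff Q E by rewrite coeffD coeffmP_neq // add0r.
apply: (IH E') => //; first by lia.
rewrite addrA; apply: inL_drop => //.
apply: contraT; rewrite cQ [1 - _]addrC => f1.
have := fL Q; rewrite cQ => /vge_eq /(_ f1) [f0 vf].
have [h [h0 hL vh]] := vanishing_function QP E'0 E'P dE'.
have := @no_simple_pole Q (n * b + e).+1 (f * h) QP.
rewrite (ff_M ffK) // vf vh coeffB coeffU1 eqxx.
rewrite (_ : - _ + _ = -1) ?eqxx; last by lia.
move=> npole; suff : ~~ true by []; apply: npole.
(* The bound is nb + e + 1 < 2g, where n + 1 + e <= a. By [eF] it follows from e + a < eb, which
   holds since b >= a + 2. *)
- have eF := ab_g; nia.
- have := inLM fL hL; congr inL.
  rewrite (_ : _ - 1 = e%:Z + (n * b)%N); last by lia.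
  by rewrite -freegUD /E' opprB addrACA subrKC.
- by rewrite mulf_neq0.
Qed.

(** * Pencils of degree a *)

Lemma comb2 (s : 'I_2 -> K) c :
  comb s c = iota (c ord0) * s ord0 + iota (c ord_max) * s ord_max.
Proof.
rewrite /comb big_ord_recl big_ord1.
by have -> : fintype.lift ord0 ord0 = ord_max :> 'I_2 by apply: val_inj.
Qed.

Definition span2 t0 t1 f : Prop := exists d e, f = iota d * t0 + iota e * t1.

Definition pencil D (s : 'I_2 -> K) E : Prop :=
  exists2 c : 'I_2 -> k, exists j, c j != 0
    & forall Q, coeff Q (E - D) = v Q (comb s c).

(** Only the span of the two sections matters, so the basis may be changed. *)
Lemma pencilE D s E : indep D s -> pencil D s E <->
  exists2 f, span2 (s ord0) (s ord_max) f /\ f != 0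
    & forall Q, coeff Q (E - D) = v Q f.
Proof.
move=> sD; split=> [[c c0 Ec]|[f [[d [e ef]] f0] Ef]].
  exists (comb s c) => //; split; last by have [] := sD c c0.
  by exists (c ord0), (c ord_max); rewrite comb2.
pose c (j : 'I_2) := if j == ord0 then d else e.
have fc : f = comb s c by rewrite comb2 ef.
exists c; last by move=> Q; rewrite Ef fc.
apply: contrapT => c0; move/eqP: f0; apply; rewrite fc /comb big1 // => j _.
have [->|cj] := eqVneq (c j) 0; first by rewrite rmorph0 mul0r.
by case: c0; exists j.
Qed.

(** Sections of equal order at P are replaced by one of them and a combination whose leading term
    cancels. The aim is that [t1 / t0] has a pole at P. *)
Lemma adapted_basis D (s : 'I_2 -> K) : indep D s -> exists t0 t1,
  [/\ t0 != 0, t1 != 0, v P t1 < v P t0, inL D t1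
    & forall f, span2 (s ord0) (s ord_max) f <-> span2 t0 t1 f].
Proof.
move=> sD.
have comb_neq0 d e : (d != 0) || (e != 0) ->
    iota d * s ord0 + iota e * s ord_max != 0.
  move=> de; pose c (j : 'I_2) := if j == ord0 then d else e.
  have [|] := sD c; last by rewrite comb2.
  by case/orP: de => ?; [exists ord0 | exists ord_max].
have s0 : s ord0 != 0.
  have := comb_neq0 1 0; rewrite rmorph1 rmorph0 mul1r mul0r addr0.
  by apply; rewrite oner_neq0.
have s1 : s ord_max != 0.
  have := comb_neq0 0 1; rewrite rmorph1 rmorph0 mul1r mul0r add0r.
  by apply; rewrite oner_neq0 orbT.
have [lt|gt|eq] := ltgtP (v P (s ord0)) (v P (s ord_max)).
- exists (s ord_max), (s ord0); split=> //; first exact: indep_inL.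
  by move=> f; split=> -[d [e ->]]; exists e, d; rewrite addrC.
- by exists (s ord0), (s ord_max); split=> //; first exact: indep_inL.
have [c hc] := cancel_leading s0 s1 eq.
have t0 : s ord0 - iota c * s ord_max != 0.
  have := comb_neq0 1 (- c); rewrite rmorph1 rmorphN mul1r mulNr; apply.
  by rewrite oner_neq0.
exists (s ord0 - iota c * s ord_max), (s ord_max); split=> //.
- by move: hc; rewrite vgeE // -eq; lia.
- exact: indep_inL.
move=> f; split=> -[d [e ->]].
  by exists d, (e + d * c); rewrite rmorphD rmorphM; ring.
by exists d, (e - d * c); rewrite rmorphB rmorphM; ring.
Qed.

(** Dividing the sections by [t0] replaces D by the effective divisor D + div [t0] and leaves the
    pencil unchanged. That divisor turns out to be aP, and the sections to span the same space as 1
    and x. *)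
Lemma unique_pencil : exists x,
  let sx := fun j : 'I_2 => if j == ord0 then 1 else x in
  indep (mP a) sx /\ forall D (s : 'I_2 -> K) E, deg D = a -> indep D s ->
    pencil D s E <-> pencil (mP a) sx E.
Proof.
have [x [x0 xP vx]] := coordinate_x; exists x => sx.
have xI : indep (mP a) sx.
  move=> c c0; have mP_const d : inL (mP a) (iota d).
    by apply: inLC => R; rewrite coeffU1; lia.
  split; last first.
    apply: inL_comb => j; rewrite /sx; case: eqP => // _.
    by rewrite -(rmorph1 iota).
  rewrite comb2 /sx /= mulr1.
  have [c10|c1] := eqVneq (c ord_max) 0.
    rewrite c10 rmorph0 mul0r addr0 fmorph_eq0.
    case: c0 => j; suff [->|->] : j = ord0 \/ j = ord_max by rewrite ?c10 ?eqxx.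
    by case: j => [[|[|//]]] ?; [left | right]; apply: val_inj.
  have cx0 : iota (c ord_max) * x != 0 by rewrite mulf_neq0 ?fmorph_eq0.
  rewrite addrC; apply: (proj1 (@v_addl P _ (iota (c ord0)) cx0 _)).
  apply: vge_le (vgeC P _).
  by rewrite (ff_M ffK) ?fmorph_eq0 // (ff_C ffK) // vx; lia.
split=> // D s E dD sD.
have [t0 [t1 [t00 t10 lt_t t1D spanE]]] := adapted_basis sD.
have [T T0] := ff_div ffK t00.
pose f := t1 / t0; pose D0 := D + T.
have f0 : f != 0 by rewrite mulf_neq0 ?invr_eq0.
have vf Q : v Q f = v Q t1 - v Q t0 by rewrite (ff_M ffK) ?invr_eq0 // vV.
have dD0 : deg D0 = a by rewrite degD (deg_principal t00 T0) addr0.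
have t0D : inL D t0.
  have [_ []] := spanE t0.
    by exists 1, 0; rewrite rmorph1 rmorph0 mul1r mul0r addr0.
  move=> d [e ->]; apply: inLD; apply: inLZ; exact: indep_inL.
have D00 Q : 0 <= coeff Q D0.
  by rewrite coeffD T0; have := t0D Q; rewrite vgeE //; lia.
have fD0 : inL D0 f.
  move=> Q; rewrite vgeE // vf coeffD T0.
  by have := t1D Q; rewrite vgeE //; lia.
pose e := `|v P f|%N; have ve : v P f = - e%:Z by rewrite /e vf; lia.
have e0 : (0 < e)%N by rewrite /e vf; lia.
pose F := D0 - mP (coeff P D0).
have FP : coeff P F = 0 by rewrite coeffB coeffmP subrr.
have F0 Q : 0 <= coeff Q F.
  have [->|QP] := eqVneq Q P; first by rewrite FP.
  by rewrite coeffB coeffmP_neq // subr0.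
have le_e : e%:Z <= coeff P D0 by have := fD0 P; rewrite vgeE // ve; lia.
have dF : deg F = a%:Z - coeff P D0 by rewrite degB degU dD0.
(* F is the part of [D0] off P, and f lies in L(eP + F). Since e <= [coeff P D0], one has deg F + e
   <= a. *)
have feP : inL (mP e) f.
  apply: (@inL_add_point_off_P F) => //; first by rewrite dF; lia.
  move=> Q; rewrite coeffD; have [->|QP] := eqVneq Q P.
    by rewrite coeffmP FP addr0 vgeE // ve.
  by have := fD0 Q; rewrite coeffB !coeffmP_neq // subr0 add0r.
(* The pole order e is a positive nongap with e <= [coeff P D0] <= a, and a is the least positive
   nongap. *)
have ea : e = a.
  have := deg_ge0 F0; rewrite dF => le_a.
  have [ea|] := ltnP e a; last by lia.
  by have := gen2_ltn_a (order_gen2 f0 feP ve) ea; lia.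
(* The point P already accounts for the whole degree a of [D0], so nothing is left for F. *)
have D0E : D0 = mP a.
  have F00 : F = 0.
    apply: fgpos_eq0P; first exact/fgposP.
    by have := deg_ge0 F0; rewrite dF; lia.
  have eD0 : coeff P D0 = a by have := deg_ge0 F0; rewrite dF; lia.
  by apply/eqP; rewrite -subr_eq0 -[X in mP X]eD0; apply/eqP.
rewrite ea in feP ve.
have [|q] := reduce_at (Q := P) feP xP x0; first by rewrite coeffmP.
rewrite mP_pred (_ : a%:Z - 1 = (a.-1)%N); last by lia.
have lt_a : (a.-1 < a)%N by lia.
move=> /(inL_ltn_a lt_a) [p fE].
have t1E : t1 = t0 * (iota p + iota q * x).
  by rewrite -fE subrK /f mulrC divfK.
have q0 : q != 0.
  apply/eqP => q0; move: fE; rewrite q0 rmorph0 mul0r subr0 => fp.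
  have p0 : p != 0 by move: f0; rewrite fp fmorph_eq0.
  by move: ve; rewrite fp (ff_C ffK) //; lia.
have iq0 : iota q != 0 by rewrite fmorph_eq0.
(* Multiplication by [t0] carries the span of 1 and x onto that of the sections, because t1 = t0(p +
   qx) with q nonzero. *)
have spanP h : span2 (s ord0) (s ord_max) (t0 * h) <-> span2 1 x h.
  rewrite spanE t1E; split=> -[d [d' e']].
    exists (d + d' * p), (d' * q); apply: (mulfI t00); rewrite e'.
    by rewrite rmorphD !rmorphM; ring.
  exists (d - d' / q * p), (d' / q).
  by rewrite e' rmorphB !rmorphM fmorphV; field.
have coeffE Q h : h != 0 ->
    (coeff Q (E - D) == v Q (t0 * h)) = (coeff Q (E - mP a) == v Q h).
  by move=> h0; rewrite -D0E (ff_M ffK) // !coeffB coeffD T0; lia.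
rewrite !pencilE //; split=> -[h [hs h0] Eh].
  exists (h / t0); last first.
    move=> Q; apply/eqP; rewrite -coeffE ?mulf_neq0 ?invr_eq0 //.
    by rewrite mulrC divfK // Eh.
  split; last by rewrite mulf_neq0 ?invr_eq0.
  by apply/spanP; rewrite mulrC divfK.
exists (t0 * h); first by split; [apply/spanP | rewrite mulf_neq0].
by move=> Q; apply/eqP; rewrite coeffE // Eh.
Qed.
End Genus.
End FunctionField.

(** * Hilbert's basis theorem *)

(** Each term may depend on all the earlier ones, which [B] receives as a sequence. *)
Lemma dependent_choice (T : Type) (B : seq T -> T -> Prop) :
  (forall s, exists x, B s x) -> exists u : nat -> T, forall n, B (mkseq u n) (u n).
Proof.
move=> /choice [F FB]; pose st n := iter n (fun s => rcons s (F s)) [::].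
exists (fun n => F (st n)) => n.
have -> : mkseq (fun n => F (st n)) n = st n; last exact: FB.
by elim: n => // n IH; rewrite mkseqS IH.
Qed.

Lemma mem_mkseqP (T : eqType) (u : nat -> T) n y :
  reflect (exists2 i, (i < n)%N & y = u i) (y \in mkseq u n).
Proof.
rewrite /mkseq; apply: (iffP mapP) => -[i i_n ->]; exists i => //.
  by rewrite mem_iota in i_n.
by rewrite mem_iota.
Qed.

Section Noetherian.

Definition ideal (A : comNzRingType) (I : A -> Prop) : Prop :=
  [/\ I 0, forall x y, I x -> I y -> I (x + y) & forall c x, I x -> I (c * x)].

(** Membership in every ideal containing [s], which avoids writing linear combinations. *)
Definition generates (A : comNzRingType) (s : seq A) (x : A) : Prop :=
  forall I : A -> Prop, ideal I -> (forall y, y \in s -> I y) -> I x.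

(** A form of the ascending chain condition: no sequence leaves the ideal of its earlier terms at
    every step. *)
Definition noetherian (A : comNzRingType) : Prop :=
  forall u : nat -> A, exists n, generates (mkseq u n) (u n).

Lemma ideal_generates (A : comNzRingType) (s : seq A) : ideal (generates s).
Proof.
split=> [I []//|x y gx gy I iI sI|c x gx I iI sI]; case: (iI) => _ ID IM.
  by apply: ID; [apply: gx | apply: gy].
by apply: IM; apply: gx.
Qed.

Lemma generates_mem (A : comNzRingType) (s : seq A) x : x \in s -> generates s x.
Proof. by move=> xs I _; apply. Qed.

Lemma generates_trans (A : comNzRingType) (s t : seq A) x :
  (forall y, y \in s -> generates t y) -> generates s x -> generates t x.
Proof. by move=> st; apply; first exact: ideal_generates. Qed.

Lemma idealB (A : comNzRingType) (I : A -> Prop) x y :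
  ideal I -> I x -> I y -> I (x - y).
Proof. by case=> _ ID IM Ix Iy; rewrite -mulN1r; apply: ID => //; apply: IM. Qed.

Lemma noetherian_field (k : fieldType) : noetherian k.
Proof.
move=> u; have [u0|/eqP u0] := pselect (u 0 = 0).
  by exists 0 => I []; rewrite u0.
exists 1%N; rewrite -[u 1%N](divfK u0).
have [_ _] := ideal_generates (mkseq u 1); apply.
by apply: generates_mem; rewrite inE.
Qed.

Lemma noetherian_surj (A B : comNzRingType) (f : {rmorphism A -> B}) :
  (forall y, exists x, f x = y) -> noetherian A -> noetherian B.
Proof.
move=> fsurj nA u; have /choice [w fw] : forall n, exists x, f x = u n by [].
have [n gn] := nA w; exists n => I [I0 ID IM] uI; rewrite -fw.
apply: (gn (fun x => I (f x))).
  by split=> [|x y|c x]; rewrite ?rmorph0 ?rmorphD ?rmorphM; auto.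
move=> y /mem_mkseqP [i i_n ->].
by rewrite fw; apply: uI; apply/mem_mkseqP; exists i.
Qed.

(** Hilbert's argument. Otherwise choose [w n] of least size in the ideal of [u], outside the ideal
    of the earlier choices. Some leading coefficient is generated by the earlier ones, and the
    matching combination [q] cancels the top term of [w n], against minimality. *)
Lemma noetherian_poly (A : comNzRingType) : noetherian A -> noetherian {poly A}.
Proof.
move=> nA u; apply: contrapT => /forallNP ng.
pose I p := exists n, generates (mkseq u n) p.
have uI n : I (u n).
  by exists n.+1; apply: generates_mem; apply/mem_mkseqP; exists n.
have mono m n p : (m <= n)%N -> generates (mkseq u m) p -> generates (mkseq u n) p.
  move=> mn; apply: generates_trans => y /mem_mkseqP [i im ->].
  by apply: generates_mem; apply/mem_mkseqP; exists i => //; apply: leq_trans im mn.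
have iI : ideal I.
  split=> [|p q [m gp] [n gq]|c p [n gp]].
  - by exists 0%N => J [].
  - have [_ gD _] := ideal_generates (mkseq u (maxn m n)).
    exists (maxn m n); apply: gD; apply: mono; try eassumption.
      exact: leq_maxl.
    exact: leq_maxr.
  - by exists n; have [_ _] := ideal_generates (mkseq u n); apply.
(* Dependent choice wants an answer for every sequence; those not contained in I get the dummy value
   0. *)
have step (s : seq {poly A}) : exists p, (forall q, q \in s -> I q) ->
    [/\ I p, ~ generates s p & forall q, I q -> ~ generates s q -> (size p <= size q)%N].
  have [sI|nsI] := pselect (forall q, q \in s -> I q); last by exists 0.
  have [N sN] : exists N, forall q, q \in s -> generates (mkseq u N) q.
    elim: s sI => [|q s IH] sI; first by exists 0%N.
    have [|N sN] := IH; first by move=> r rs; apply: sI; rewrite inE rs orbT.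
    have [M gM] := sI q (mem_head _ _); exists (maxn M N) => r.
    rewrite inE => /predU1P [->|/sN].
      exact: mono (leq_maxl _ _) gM.
    exact: mono (leq_maxr _ _).
  have ex : exists n, `[< exists p, [/\ I p, ~ generates s p & size p = n] >].
    exists (size (u N)); apply/asboolP; exists (u N); split=> //.
    by move=> /(generates_trans sN); apply: ng.
  have /asboolP [p [Ip np sp]] := xchooseP ex.
  case: (ex_minnP ex) => m /asboolP [{}p [{}Ip {}np {}sp]] minm.
  exists p => _; split=> // q Iq nq; rewrite sp; apply: minm.
  by apply/asboolP; exists q.
have [w wP] := dependent_choice step.
have wI n : I (w n).
  elim/ltn_ind: n => n IH; have [|//] := wP n.
  by move=> q /mem_mkseqP [i /IH Ii ->].
have {}wP n : ~ generates (mkseq w n) (w n) /\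
    forall q, I q -> ~ generates (mkseq w n) q -> (size (w n) <= size q)%N.
  by have [|_ ? ?] := wP n; first by move=> q /mem_mkseqP [i _ ->].
have [n gn] := nA (fun i => lead_coef (w i)).
have [ngn minn] := wP n; pose N := size (w n).
have wn0 : w n != 0.
  by apply/eqP => w0; apply: ngn; rewrite w0 => J [].
have N0 : (0 < N)%N by rewrite size_poly_gt0.
(* The coefficients in degree N - 1 of generated polynomials of size at most N. They form an ideal,
   which contains the earlier leading coefficients after a shift by a power of ['X]. *)
pose J x := exists q, [/\ generates (mkseq w n) q, (size q <= N)%N & q`_N.-1 = x].
have [_ gD gM] := ideal_generates (mkseq w n).
have [q [gq sq eq]] : J (lead_coef (w n)).
  apply: gn.
    split=> [|x y [p [gp sp ep]] [q [gq sq eq]]|c x [p [gp sp ep]]].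
    - exists 0; rewrite size_poly0 coef0; split=> //; by move=> ? [].
    - exists (p + q); split; first exact: gD.
        by apply: leq_trans (size_polyD _ _) _; rewrite geq_max sp.
      by rewrite coefD ep eq.
    - exists (c%:P * p); split; first exact: gM.
        rewrite mul_polyC; exact: leq_trans (size_scale_leq _ _) sp.
      by rewrite coefCM ep.
  move=> x /mem_mkseqP [i i_n ->].
  have wi0 : w i != 0.
    have [ngi _] := wP i.
    by apply/eqP => w0; apply: ngi; rewrite w0 => ? [].
  have siN : (size (w i) <= N)%N.
    have [_ mini] := wP i; apply: mini; first exact: wI.
    move=> gi; apply: ngn; apply: generates_trans gi => y.
    move=> /mem_mkseqP [j ji ->]; apply: generates_mem; apply/mem_mkseqP; exists j => //.
    exact: ltn_trans ji i_n.
  exists ('X^(N - size (w i)) * w i); split.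
  - by apply: gM; apply: generates_mem; apply/mem_mkseqP; exists i.
  - by rewrite mulrC size_mulXn // subnK.
  - have w_gt0 : (0 < size (w i))%N by rewrite size_poly_gt0.
    rewrite coefXnM ifF; last by apply/negbTE; lia.
    by rewrite lead_coefE; congr (_`_ _); lia.
have ngq : ~ generates (mkseq w n) (w n - q).
  by move=> /gD /(_ gq); rewrite subrK.
have Iq : I q.
  by apply: gq => // y /mem_mkseqP [i _ ->].
have := minn _ (idealB iI (wI n) Iq) ngq; rewrite leqNgt => /negP; apply.
rewrite -/N -(prednK N0) ltnS; apply/leq_sizeP => j.
rewrite leq_eqVlt => /predU1P [<-|lt_j].
  by rewrite coefB eq lead_coefE subrr.
have jN : (N <= j)%N by rewrite -(prednK N0).
by rewrite coefB !nth_default ?subrr // (leq_trans sq).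
Qed.

(** By induction: a polynomial in one variable over the ring in n variables is evaluated at the last
    of n+1 variables, and this map is onto. *)
Lemma noetherian_mpoly (k : fieldType) n : noetherian {mpoly k[n]}.
Proof.
elim: n => [|n IH].
  apply: (noetherian_surj (f := @mpolyC 0 k)) (@noetherian_field k) => p.
  by exists (p@_0%MM); exact/esym/nvar0_mpolyC.
pose f : {rmorphism {poly {mpoly k[n]}} -> {mpoly k[n.+1]}} :=
  horner_eval 'X_ord_max \o @mpwiden n k.
apply: (noetherian_surj (f := f)) (noetherian_poly IH) => p.
have fD q r : (exists x, f x = q) -> (exists x, f x = r) -> exists x, f x = q + r.
  by case=> x <- [y <-]; exists (x + y); rewrite rmorphD.
have fM q r : (exists x, f x = q) -> (exists x, f x = r) -> exists x, f x = q * r.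
  by case=> x <- [y <-]; exists (x * y); rewrite rmorphM.
have fC c : exists x, f x = c%:MP.
  by exists (c%:MP)%:P; rewrite /= mpwidenC /horner_eval hornerC mwidenC.
have fX i : exists x, f x = 'X_i.
  case: (unliftP ord_max i) => [j ->|->]; last first.
    by exists 'X; rewrite /= /mpwiden map_polyX /horner_eval hornerX.
  exists ('X_j)%:P; rewrite /= mpwidenC /horner_eval hornerC mwidenX mnmwiden1.
  congr 'X_[U_(_)]; apply: val_inj; by rewrite /= /bump leqNgt ltn_ord.
rewrite (mpolyE p); elim/big_ind: _ => [|q r|m _].
- by exists 0; rewrite rmorph0.
- exact: fD.
- rewrite -mul_mpolyC; apply: (fM) => //; rewrite mpolyXE_id.
  elim/big_ind: _ => [|q r|i _].
  + by exists 1; rewrite rmorph1.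
  + exact: fM.
  + elim: (m i) => [|d IHd]; first by exists 1; rewrite rmorph1 expr0.
    by rewrite exprS; apply: (fM).
Qed.

(** Quasi-compactness of affine space. Otherwise one could forever choose members of S that do not
    vanish at some common zero of the earlier ones; but the polynomials vanishing at a given point
    form an ideal. *)
Lemma finite_zeros (k : fieldType) n (S : {mpoly k[n]} -> Prop) :
  exists2 s : seq {mpoly k[n]}, forall f, f \in s -> S f
    & forall x, (forall f, f \in s -> f.@[x] = 0) -> forall f, S f -> f.@[x] = 0.
Proof.
apply: contrapT => /forall2NP no.
have [|u uP] := @dependent_choice {mpoly k[n]} (fun s f =>
    (forall h, h \in s -> S h) ->
    S f /\ exists2 x, forall h, h \in s -> h.@[x] = 0 & f.@[x] <> 0).
  move=> s; have [ns|nx] := no s; first by exists 0 => /ns.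
  have [sS|ns] := pselect (forall f, f \in s -> S f); last by exists 0.
  move/existsNP: nx => [x /not_implyP [sx /existsNP [f /not_implyP [Sf fx]]]].
  by exists f => _; split=> //; exists x.
have uS m : S (u m).
  elim/ltn_ind: m => m IH; have [|//] := uP m.
  by move=> q /mem_mkseqP [i /IH Ii ->].
have [m gm] := @noetherian_mpoly k n u.
have [|_ [x ux]] := uP m; first by move=> q /mem_mkseqP [i _ ->].
apply; apply: (gm (fun f => f.@[x] = 0)) => //.
split=> [|f h fx hx|c f fx]; first by rewrite meval0.
  by rewrite mevalD fx hx addr0.
by rewrite mevalM fx mulr0.
Qed.

End Noetherian.

(** * The fraction field of a quotient *)

Section QuotientField.
Local Open Scope quotient_scope.
Variables (A : comNzRingType) (I : prime_idealr A).

(** A separate name for the quotient, to carry the unit ring and domain structures that the fraction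
    field requires; inverses come from classical choice. *)
Definition quotient_domain : Type := {ideal_quot I}.
HB.instance Definition _ := GRing.ComNzRing.on quotient_domain.

Definition quotient_unit (x : quotient_domain) : bool :=
  `[< exists y, y * x == 1 >].

Definition quotient_inv (x : quotient_domain) : quotient_domain :=
  if pselect (exists y, y * x == 1) is left ex_y then xchoose ex_y else x.

Fact quotient_mulVx : {in quotient_unit, left_inverse 1 quotient_inv *%R}.
Proof.
move=> x /asboolP ex_y; rewrite /quotient_inv.
by case: pselect => // ex_y'; apply/eqP/(xchooseP ex_y').
Qed.

Fact quotient_unitPl (x y : quotient_domain) : y * x = 1 -> quotient_unit x.
Proof. by move=> yx; apply/asboolP; exists y; apply/eqP. Qed.

Fact quotient_inv_out : {in [predC quotient_unit], quotient_inv =1 id}.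
Proof.
move=> x; rewrite inE /= /quotient_inv => /asboolPn nx.
by case: pselect.
Qed.

HB.instance Definition _ := GRing.ComNzRing_hasMulInverse.Build quotient_domain
  quotient_mulVx quotient_unitPl quotient_inv_out.

HB.instance Definition _ := GRing.ComUnitRing_isIntegral.Build quotient_domain
  (@Quotient.rquot_IdomainAxiom A I).

Definition to_quotient_field (x : A) : {fraction quotient_domain} :=
  FracField.tofrac (\pi_{ideal_quot I} x : quotient_domain).

Fact to_quotient_field_zmod_morphism : zmod_morphism to_quotient_field.
Proof. by move=> x y; rewrite /to_quotient_field rmorphB tofracB. Qed.

Fact to_quotient_field_monoid_morphism : monoid_morphism to_quotient_field.
Proof.
split; first by rewrite /to_quotient_field rmorph1 tofrac1.
by move=> x y; rewrite /to_quotient_field rmorphM tofracM.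
Qed.

HB.instance Definition _ := GRing.isZmodMorphism.Build A
  {fraction quotient_domain} to_quotient_field to_quotient_field_zmod_morphism.
HB.instance Definition _ := GRing.isMonoidMorphism.Build A
  {fraction quotient_domain} to_quotient_field to_quotient_field_monoid_morphism.

Lemma to_quotient_field_eq0 x : (to_quotient_field x == 0) = (x \in I).
Proof.
rewrite tofrac_eq0 -(rmorph0 (\pi_{ideal_quot I} : A -> _)).
by rewrite -Quotient.idealrBE subr0.
Qed.

Lemma to_quotient_field_frac f : exists x y,
  to_quotient_field y != 0 /\ f = to_quotient_field x / to_quotient_field y.
Proof.
have [r ->] : exists r, f = \pi_({fraction quotient_domain}) r.
  by exists (repr f); rewrite reprK.
have [x xE] : exists x : A, \n_r = \pi_{ideal_quot I} x.
  by exists (repr \n_r); rewrite reprK.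
have [y yE] : exists y : A, \d_r = \pi_{ideal_quot I} y.
  by exists (repr \d_r); rewrite reprK.
have y0 : to_quotient_field y != 0.
  by rewrite /to_quotient_field tofrac_eq0 -yE denom_ratioP.
exists x, y; split=> //; apply: (canRL (mulfK y0)).
rewrite /to_quotient_field -xE -yE !piE; apply/eqmodP => /=.
rewrite FracField.equivfE /FracField.mulf.
have pi1 : \pi_{ideal_quot I} 1 = 1 by exact: rmorph1.
rewrite ?pi1.
by rewrite !numden_Ratio ?mulf_neq0 ?oner_neq0 ?denom_ratioP // !mulr1 mulrC.
Qed.

End QuotientField.

Lemma prime_ideal_field (A : comNzRingType) (I : A -> Prop) :
  I 0 -> (forall x y, I x -> I y -> I (x - y)) -> (forall c x, I x -> I (c * x)) ->
  ~ I 1 -> (forall x y, I (x * y) -> I x \/ I y) ->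
  exists (K : fieldType) (rho : {rmorphism A -> K}),
    (forall x, rho x = 0 <-> I x)
    /\ (forall f, exists x y, rho y != 0 /\ f = rho x / rho y).
Proof.
move=> I0 IB IM nI1 Iprime; pose J := fun x => `[< I x >].
have J_ideal : idealr_closed J.
  split; rewrite -?topredE /=; first exact/asboolP.
    exact/asboolPn.
  move=> c x y /asboolP Ix /asboolP Iy; apply/asboolP.
  have -> : c * x + y = c * x - (0 - y) by rewrite sub0r opprK.
  by apply: (IB); [apply: IM | apply: (IB)].
have J_prime : prime_idealr_closed J.
  by move=> x y /asboolP /Iprime [?|?]; apply/orP; [left|right]; apply/asboolP.
pose Jp : prime_idealr A := HB.pack_for (prime_idealr A) J
  (isIdealr.Build A J J_ideal) (isPrimeIdealrClosed.Build A J J_prime).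
exists {fraction quotient_domain Jp}, (@to_quotient_field A Jp); split.
  move=> x; split=> [/eqP|Ix]; last apply/eqP.
    by rewrite to_quotient_field_eq0 => /asboolP.
  by rewrite to_quotient_field_eq0; apply/asboolP.
exact: to_quotient_field_frac.
Qed.

(** * Projective curves *)

Local Open Scope classical_set_scope.

(** * Forms and points of projective space *)

Section Forms.
Variables (R : realType) (n : nat).
Local Notation mp := {mpoly R[i][n.+1]}.
Local Notation hdeg := form_of_degree.
Implicit Types (F G : mp) (P Q : proj_space R n).

Lemma hdegM d e F G : hdeg d F -> hdeg e G -> hdeg (d + e) (F * G).
Proof. exact: dhomogM. Qed.

Lemma hdegX d e F : hdeg d F -> hdeg (e * d) (F ^+ e).
Proof. by rewrite /hdeg mulnC; apply: dhomogMn. Qed.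

Lemma hdegB d F G : hdeg d F -> hdeg d G -> hdeg d (F - G).
Proof. by move=> hF hG; apply: rpredB. Qed.

Lemma hdegZ d c F : hdeg d F -> hdeg d (c *: F).
Proof. exact: dhomogZ. Qed.

Lemma hdegC c : hdeg 0 (c%:MP : mp).
Proof. by rewrite -[c%:MP]mulr1 mul_mpolyC; apply/dhomogZ/dhomog1. Qed.

Lemma hdeg1 : hdeg 0 (1 : mp).
Proof. exact: dhomog1. Qed.

Lemma hdegXi i : hdeg 1 ('X_i : mp).
Proof. by rewrite /hdeg dhomogX /= mdeg1. Qed.

Lemma hdeg_sum (I : Type) (r : seq I) (p : pred I) d (F : I -> mp) :
  (forall i, p i -> hdeg d (F i)) -> hdeg d (\sum_(i <- r | p i) F i).
Proof. by move=> hF; apply: rpred_sum. Qed.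

Lemma hdeg_prod (I : Type) (r : seq I) (p : pred I) (d : I -> nat) (F : I -> mp) :
  (forall i, hdeg (d i) (F i)) ->
  hdeg (\sum_(i <- r | p i) d i)%N (\prod_(i <- r | p i) F i).
Proof.
move=> hF; elim/big_ind2: _ => [|d1 F1 d2 F2|//]; first exact: hdeg1.
by move=> h1 h2; apply: hdegM.
Qed.

Lemma meval_scale d F c (x : 'rV[R[i]]_n.+1) : hdeg d F ->
  F.@[(c *: x) 0] = c ^+ d * F.@[x 0].
Proof.
move=> hF; rewrite !mevalE big_distrr /=; apply: eq_big_seq => m m_in.
rewrite mulrCA; congr (_ * _).
under eq_bigr do rewrite mxE exprMn.
rewrite big_split /=; congr (_ * _).
rewrite prodrXr -(dhomog_mf hF m_in); congr (_ ^+ _).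
by rewrite /= mdegE.
Qed.

Definition rep P : 'rV[R[i]]_n.+1 := vpick (val P).

(** The value depends on the vector chosen on the line. For forms, its vanishing and the quotients
    of values in equal degree do not. *)
Definition ev P F : R[i] := F.@[rep P 0].

Lemma rep_mem P : rep P \in val P. Proof. exact: memv_pick. Qed.

Lemma rep_neq0 P : rep P != 0.
Proof.
rewrite vpick0; apply/eqP => P0; have := valP P; rewrite P0 dimv0.
by [].
Qed.

Lemma val_rep P : val P = <[rep P]>%VS.
Proof.
apply/esym/eqP; rewrite eqEdim -memvE rep_mem (eqP (valP P)) dim_vline.
by rewrite rep_neq0.
Qed.

Lemma evM P F G : ev P (F * G) = ev P F * ev P G. Proof. exact: mevalM. Qed.
Lemma evB P F G : ev P (F - G) = ev P F - ev P G. Proof. exact: mevalB. Qed.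
Lemma evX P F k : ev P (F ^+ k) = ev P F ^+ k. Proof. exact: rmorphXn. Qed.
Lemma ev1 P : ev P 1 = 1. Proof. exact: meval1. Qed.
Lemma evZ P c F : ev P (c *: F) = c * ev P F. Proof. exact: mevalZ. Qed.
Lemma evXi P i : ev P 'X_i = rep P 0 i. Proof. exact: mevalXU. Qed.
Lemma ev_const P c : ev P c%:MP = c. Proof. exact: mevalC. Qed.
Lemma ev_prod P (I : Type) (r : seq I) (p : pred I) (F : I -> mp) :
  ev P (\prod_(i <- r | p i) F i) = \prod_(i <- r | p i) ev P (F i).
Proof. exact: rmorph_prod. Qed.

Lemma vanishes_ev P F : vanishes_at F P -> ev P F = 0.
Proof. by move/(_ _ (rep_mem P)). Qed.

Lemma vanishes_atE P F d : hdeg d F -> vanishes_at F P <-> ev P F = 0.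
Proof.
move=> hF; split=> [|F0 x]; first exact: vanishes_ev.
by rewrite val_rep => /vlineP [c ->]; rewrite (meval_scale _ _ hF) -/(ev P F) F0 mulr0.
Qed.

Lemma vanishes_onE (Z : set (proj_space R n)) F d : hdeg d F ->
  vanishes_on F Z <-> forall P, Z P -> ev P F = 0.
Proof.
by move=> hF; split=> F0 P ZP; [apply/vanishes_ev/F0 | apply/(vanishes_atE P hF)/F0].
Qed.

Lemma coordinate_neq0 P : exists i, ev P 'X_i != 0.
Proof. by case/rV0Pn: (rep_neq0 P) => i; exists i; rewrite evXi. Qed.

Lemma point_eq P Q i : rep P 0 i != 0 ->
  (forall j, rep P 0 i * rep Q 0 j = rep P 0 j * rep Q 0 i) -> Q = P.
Proof.
move=> Pi0 PQ; apply: val_inj; rewrite [val Q]val_rep [val P]val_rep.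
apply/eqP; rewrite eqEdim !dim_vline !rep_neq0 andbT -memvE.
apply/vlineP; exists (rep Q 0 i / rep P 0 i); apply/rowP => j; rewrite mxE.
apply: (mulfI Pi0); rewrite PQ; field.
by [].
Qed.

(* On the line over a point where [F] and [G] do not vanish, they scale with
   their degrees. *)
Lemma degree_match (Z : set (proj_space R n)) F G d e : hdeg d F -> hdeg e G ->
  vanishes_on (F - G) Z -> ~ vanishes_on F Z -> d = e.
Proof.
move=> hF hG FG /(vanishes_onE _ hF) /existsNP [P /not_implyP [ZP /eqP F0]].
have FGc c : c ^+ d * ev P F = c ^+ e * ev P G.
  have cP : c *: rep P \in val P by rewrite memvZ ?rep_mem.
  have := FG P ZP _ cP; rewrite mevalB (meval_scale _ _ hF) (meval_scale _ _ hG).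
  by move/eqP; rewrite subr_eq0 => /eqP.
have := FGc 1; rewrite !expr1n !mul1r => eFG.
have := FGc 2; rewrite -eFG => /(mulIf F0) /eqP.
rewrite -!natrX eqr_nat => /eqP /(congr1 (logn 2)).
by rewrite !lognX !logn_prime // !muln1.
Qed.

End Forms.

Arguments hdeg1 {R n}.
Arguments hdegXi {R n}.
Arguments hdegC {R n}.


(** * The function field of the curve *)

Section Curve.
Variables (R : realType) (n : nat) (C : set (proj_space R n)).
Local Notation mp := {mpoly R[i][n.+1]}.
Local Notation hdeg := form_of_degree.
Local Notation pt := (set_type C).
Implicit Types (F G U V : mp) (P Q : pt).
Hypothesis C_curve : smooth_projective_curve C.

Local Notation evC P F := (ev (val P) F).

Lemma point_mem P : C (val P).
Proof. exact: set_valP. Qed.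

Lemma vanishes_onP F d : hdeg d F -> vanishes_on F C <-> forall P, evC P F = 0.
Proof.
move=> hF; rewrite (vanishes_onE _ hF); split=> F0 P; first exact/F0/point_mem.
by move=> CP; apply: (F0 (SigSub (mem_set CP))).
Qed.

Lemma zero_locus_closed F d : hdeg d F -> proj_closed [set P | vanishes_at F P].
Proof.
move=> hF; exists [set F]; first by move=> ? ->; exists d.
by apply/seteqP; split=> P /=; [move=> FP ? -> | apply].
Qed.

(** The two zero loci cover the irreducible set C. *)
Lemma vanishes_on_prime F G d e : hdeg d F -> hdeg e G ->
  vanishes_on (F * G) C -> vanishes_on F C \/ vanishes_on G C.
Proof.
move=> hF hG FG; have [[_ _ irr] _ _] := C_curve.
have := irr _ _ (zero_locus_closed hF) (zero_locus_closed hG).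
apply=> P CP; have := vanishes_ev (FG P CP); rewrite evM => /eqP.
rewrite mulf_eq0 => /orP [] /eqP e0.
  by left; apply/(vanishes_atE P hF).
by right; apply/(vanishes_atE P hG).
Qed.

Lemma exists_coordinate : exists i, ~ vanishes_on 'X_i C.
Proof.
have [[_ [P CP] _] _ _] := C_curve; have [i Pi] := coordinate_neq0 P.
by exists i => /(_ P CP) /vanishes_ev /eqP; apply/negP.
Qed.

Lemma homogenize i F m : (msize F <= m)%N ->
  exists2 F', hdeg m F' & forall x : 'I_n.+1 -> R[i], x i = 1 -> F'.@[x] = F.@[x].
Proof.
move=> Fm; exists (\sum_(u <- msupp F) F@_u *: ('X_[u] * 'X_i ^+ (m - mdeg u))).
  rewrite big_seq; apply: hdeg_sum => u uF; apply: hdegZ.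
  have um : (mdeg u <= m)%N.
    exact: leq_trans (ltnW (msize_mdeg_lt uF)) Fm.
  rewrite -[m in hdeg m](subnKC um); apply: hdegM; first by rewrite /hdeg dhomogX.
  by rewrite -[X in hdeg X]muln1; apply/hdegX/hdegXi.
move=> x xi; rewrite [in RHS](mpolyE F) !raddf_sum /=; apply: eq_bigr => u _.
by rewrite !mevalZ mevalM rmorphXn /= mevalXU xi expr1n mulr1.
Qed.

(* The function field is obtained by setting to 1 a coordinate that does not
   vanish identically on the curve. *)
Lemma function_field_exists : exists (K : fieldType) (rho : {rmorphism mp -> K}),
  (forall F d, hdeg d F -> rho F = 0 <-> vanishes_on F C) /\
  (forall f, exists d F G, [/\ hdeg d F, hdeg d G, rho G != 0 & f = rho F / rho G]).
Proof.
have [i nXi] := exists_coordinate.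
(* [aff P] is P in the chart where the i-th coordinate is 1, and [I] is the ideal of the part of C
   in that chart. *)
pose aff P := fun j => rep (val P) 0 j / rep (val P) 0 i.
pose I F := forall P, evC P 'X_i != 0 -> F.@[aff P] = 0.
have aff_ev P F d : hdeg d F -> evC P 'X_i != 0 ->
    F.@[aff P] = (rep (val P) 0 i)^-1 ^+ d * evC P F.
  move=> hF _; rewrite -(meval_scale _ _ hF); apply: meval_eq => j.
  by rewrite /aff mxE mulrC.
have aff1 P : evC P 'X_i != 0 -> aff P i = 1.
  by rewrite evXi /aff => ?; rewrite divff.
have IE F d : hdeg d F -> I F <-> vanishes_on F C.
  move=> hF; split=> [IF|F0 P Pi]; last first.
    by rewrite (aff_ev _ _ _ hF) // (proj1 (vanishes_onP hF) F0) mulr0.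
  (* The factor ['X_i] takes care of the points outside the chart; it does not vanish on C, so
     irreducibility removes it. *)
  have : vanishes_on ('X_i * F) C.
    apply/(vanishes_onP (hdegM (hdegXi i) hF)) => P; rewrite evM.
    have [->|Pi] := eqVneq (evC P 'X_i) 0; first by rewrite mul0r.
    have := IF P Pi; rewrite (aff_ev _ _ _ hF) // => /eqP.
    rewrite mulf_eq0 expf_eq0 invr_eq0 -evXi (negPf Pi) andbF /= => /eqP ->.
    by rewrite mulr0.
  by case/(vanishes_on_prime (hdegXi i) hF).
have IB F G : I F -> I G -> I (F - G).
  by move=> IF IG P Pi; rewrite mevalB IF // IG // subr0.
have IM F G : I G -> I (F * G).
  by move=> IG P Pi; rewrite mevalM IG // mulr0.
have Ihom F m : (msize F <= m)%N -> exists2 F', hdeg m F' & I (F' - F).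
  case/(homogenize i) => F' hF' eF; exists F' => // P Pi.
  by rewrite mevalB eF ?subrr // aff1.
have [||||F G IFG|K [rho [rho0 rhof]]] :=
  @prime_ideal_field (mp : comNzRingType) I.
- by move=> P _; rewrite meval0.
- exact: IB.
- exact: IM.
- by move=> /(IE _ _ hdeg1) /(vanishes_onP hdeg1) I1;
    case: exists_coordinate => j []; have [[_ [P CP] _] _ _] := C_curve;
    have := I1 (SigSub (mem_set CP)); rewrite ev1 => /eqP; rewrite oner_eq0.
(* [vanishes_on_prime] concerns forms only, so F and G are first homogenized without changing their
   values on the chart. *)
- have [F' hF' eF] := Ihom F _ (leq_maxl _ (msize G)).
  have [G' hG' eG] := Ihom G _ (leq_maxr (msize F) _).
  have : I (F' * G').
    move=> P Pi; rewrite mevalM.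
    have /eqP := eF P Pi; rewrite mevalB subr_eq0 => /eqP ->.
    have /eqP := eG P Pi; rewrite mevalB subr_eq0 => /eqP ->.
    by rewrite -mevalM IFG.
  move/(IE _ _ (hdegM hF' hG')) => /(vanishes_on_prime hF' hG') [].
    move/(IE _ _ hF') => IF'; left; rewrite -[F](subKr F'); exact: IB.
  move/(IE _ _ hG') => IG'; right; rewrite -[G](subKr G'); exact: IB.
exists K, rho; split=> [F d hF|f]; first by rewrite rho0 (IE _ _ hF).
have [F [G [G0 ->]]] := rhof f.
have [F' hF' eF] := Ihom F _ (leq_maxl _ (msize G)).
have [G' hG' eG] := Ihom G _ (leq_maxr (msize F) _).
have rhoE H H' : I (H' - H) -> rho H = rho H'.
  by move/rho0; rewrite rmorphB => /eqP; rewrite subr_eq0 => /eqP ->.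
exists (maxn (msize F) (msize G)), F', G'; split=> //.
  by rewrite -(rhoE _ _ eG).
by rewrite (rhoE _ _ eF) (rhoE _ _ eG).
Qed.

Lemma uniformizer_choice : exists (T : pt -> mp) (d : pt -> nat) (H : pt -> mp),
  forall P, [/\ uniformizer C (val P) (T P), hdeg (d P) (T P), hdeg 1 (H P)
    & evC P (H P) != 0].
Proof.
have [_ _ unif] := C_curve.
have /choice [u uP] : forall P, exists x : mp * nat * mp,
    [/\ uniformizer C (val P) x.1.1, hdeg x.1.2 x.1.1, hdeg 1 x.2
      & evC P x.2 != 0].
  move=> P; have [T TP] := unif _ (point_mem P).
  have [d hT] : form T by case: TP.
  have [i Pi] := coordinate_neq0 (val P).
  by exists (T, d, 'X_i); split=> //=; apply: hdegXi.
by exists (fun P => (u P).1.1), (fun P => (u P).1.2), (fun P => (u P).2).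
Qed.

(** * Valuations at the points of the curve *)

Section Places.
Variables (K : fieldType) (rho : {rmorphism mp -> K}).
Hypothesis rho_eq0 : forall F d, hdeg d F -> rho F = 0 <-> vanishes_on F C.
Hypothesis rho_frac : forall f, exists d F G,
  [/\ hdeg d F, hdeg d G, rho G != 0 & f = rho F / rho G].
Variables (T : pt -> mp) (d : pt -> nat) (H : pt -> mp).
Hypothesis TH : forall P, [/\ uniformizer C (val P) (T P), hdeg (d P) (T P),
  hdeg 1 (H P) & evC P (H P) != 0].

Lemma T_hdeg P : hdeg (d P) (T P). Proof. by have [] := TH P. Qed.
Lemma H_hdeg P : hdeg 1 (H P). Proof. by have [] := TH P. Qed.
Lemma evH P : evC P (H P) != 0. Proof. by have [] := TH P. Qed.
Lemma evT P : evC P (T P) = 0.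
Proof. by have [[_ T0 _ _] _ _ _] := TH P; apply: vanishes_ev. Qed.

Lemma rho_neq0P F m : hdeg m F -> ~ vanishes_on F C <-> rho F != 0.
Proof.
move=> hF; split=> [nF|/eqP F0 /(rho_eq0 hF)//].
by apply/eqP => /(rho_eq0 hF).
Qed.

Lemma rho_neq0 P F m : hdeg m F -> evC P F != 0 -> rho F != 0.
Proof.
move=> hF; apply: contraNN => /eqP /(rho_eq0 hF) /(vanishes_onP hF) -> //.
Qed.

Lemma rho_eq_ev P F G m : hdeg m F -> hdeg m G -> rho F = rho G ->
  evC P F = evC P G.
Proof.
move=> hF hG eFG; apply/eqP; rewrite -subr_eq0 -evB; apply/eqP.
move: P; apply/(vanishes_onP (hdegB hF hG))/(rho_eq0 (hdegB hF hG)).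
by rewrite rmorphB eFG subrr.
Qed.

Lemma vanishes_onB_rho F G m e : hdeg m F -> hdeg e G ->
  vanishes_on (F - G) C -> rho F != 0 -> m = e /\ rho F = rho G.
Proof.
move=> hF hG FG F0.
have me := degree_match hF hG FG (proj2 (rho_neq0P hF) F0).
split=> //; subst e; move/(rho_eq0 (hdegB hF hG)): FG.
by rewrite rmorphB => /eqP; rewrite subr_eq0 => /eqP.
Qed.

Lemma rhoT_neq0 P : rho (T P) != 0.
Proof. by have [[_ _ nT _] hT _ _] := TH P; apply/(rho_neq0P hT). Qed.

Lemma rhoH_neq0 P : rho (H P) != 0.
Proof. exact: rho_neq0 (H_hdeg P) (evH P). Qed.

(** The uniformizer made into a rational function, of degree 0, by a power of a linear form that
    does not vanish at P. *)
Definition loc P : K := rho (T P) / rho (H P) ^+ d P.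

Lemma loc_neq0 P : loc P != 0.
Proof. by rewrite mulf_neq0 ?invr_eq0 ?expf_neq0 ?rhoT_neq0 ?rhoH_neq0. Qed.

(* The numerator and the denominator must be matched in degree with [F]: [rho]
   sets a coordinate to 1, which may vanish at [P], so that a quotient of forms
   of different degrees nonvanishing at [P] need not be a unit there. *)
Definition ord_at P m F (k : nat) : Prop := exists p A B,
  [/\ hdeg (p + m) A, hdeg p B, evC P A != 0, evC P B != 0
    & rho F = rho A / rho B * loc P ^+ k].

(** After clearing denominators, a positive power would make one side vanish at P and not the
    other. *)
Lemma unit_loc P p A B k : hdeg p A -> hdeg p B -> evC P A != 0 ->
  evC P B != 0 -> rho A / rho B = loc P ^+ k -> k = 0%N.
Proof.
move=> hA hB A0 B0; case: k => // k eAB.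
have rB := rho_neq0 hB B0.
have : rho (A * H P ^+ (k.+1 * d P)) = rho (T P ^+ k.+1 * B).
  rewrite !rmorphM !rmorphXn /= -[rho A](divfK rB) eAB /loc exprMn exprVn.
  rewrite -exprM mulnC; field.
  by rewrite expf_neq0 // rhoH_neq0.
have hl : hdeg (p + k.+1 * d P * 1) (A * H P ^+ (k.+1 * d P)).
  by apply: hdegM => //; apply/hdegX/H_hdeg.
have hr : hdeg (p + k.+1 * d P * 1) (T P ^+ k.+1 * B).
  by rewrite muln1 addnC; apply: hdegM => //; apply/hdegX/T_hdeg.
move/(rho_eq_ev P hl hr); rewrite !evM !evX evT exprS mul0r mul0r => /eqP.
by rewrite mulf_eq0 expf_eq0 (negPf A0) (negPf (evH P)) andbF.
Qed.

Lemma ord_at_uniq P m F F' k k' : ord_at P m F k -> ord_at P m F' k' ->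
  rho F = rho F' -> k = k'.
Proof.
wlog le_k : F F' k k' / (k <= k')%N => [IH oF oF' e|].
  have [le_k|/ltnW le_k] := leqP k k'; first exact: IH oF oF' e.
  by apply/esym; apply: IH oF' oF (esym e).
move=> [p [A [B [hA hB A0 B0 ->]]]] [p' [A' [B' [hA' hB' A'0 B'0 ->]]]] e.
suff : (k' - k = 0)%N by lia.
apply: (@unit_loc P (p + m + p') (A * B') (A' * B)).
- exact: hdegM.
- by rewrite (_ : (_ + _)%N = (p' + m + p)%N); [apply: hdegM|lia].
- by rewrite evM mulf_neq0.
- by rewrite evM mulf_neq0.
apply: (mulIf (expf_neq0 k (loc_neq0 P))); rewrite -exprD subnK // !rmorphM.
have := rho_neq0 hA' A'0; have := rho_neq0 hB' B'0; have := rho_neq0 hB B0.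
move=> B1 B'1 A'1.
have -> : rho A * rho B' / (rho A' * rho B) * loc P ^+ k =
    (rho A / rho B * loc P ^+ k) * (rho B' / rho A') by field; rewrite B1 A'1.
by rewrite e; field; rewrite B'1 A'1.
Qed.

Lemma ord_atM P m F k m' F' k' : ord_at P m F k -> ord_at P m' F' k' ->
  ord_at P (m + m') (F * F') (k + k').
Proof.
move=> [p [A [B [hA hB A0 B0 e]]]] [p' [A' [B' [hA' hB' A'0 B'0 e']]]].
exists (p + p')%N, (A * A'), (B * B'); split.
- by rewrite addnACA; apply: hdegM.
- exact: hdegM.
- by rewrite evM mulf_neq0.
- by rewrite evM mulf_neq0.
have B1 := rho_neq0 hB B0; have B'1 := rho_neq0 hB' B'0.
by rewrite !rmorphM e e' exprD; field; rewrite B1 B'1.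
Qed.

Lemma ord_at_unit P m F : hdeg m F -> evC P F != 0 -> ord_at P m F 0.
Proof.
move=> hF F0; exists 0%N, F, 1; split=> //; first exact: hdeg1.
  by rewrite ev1 oner_neq0.
by rewrite rmorph1 divr1 mulr1.
Qed.

Lemma ord_atX P m F k j : ord_at P m F k -> ord_at P (j * m) (F ^+ j) (j * k).
Proof.
move=> oF; elim: j => [|j IH]; last by rewrite exprS !mulSn; apply: ord_atM.
by rewrite !mul0n; apply: ord_at_unit; rewrite ?ev1 ?oner_neq0 //; apply: hdeg1.
Qed.

Lemma ord_at_loc P : ord_at P (d P) (T P) 1.
Proof.
exists 0%N, (H P ^+ d P), 1; split.
- by rewrite add0n -[X in hdeg X]muln1; apply/hdegX/H_hdeg.
- exact: hdeg1.
- by rewrite evX expf_neq0 ?evH.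
- by rewrite ev1 oner_neq0.
by rewrite rmorph1 divr1 rmorphXn expr1 mulrC divfK // expf_neq0 ?rhoH_neq0.
Qed.

Lemma local_order_ord P m F k : hdeg m F -> rho F != 0 ->
  local_order C (val P) (T P) F k -> ord_at P m F k.
Proof.
move=> hF F0 [U [V [[du hU] [dv hV] nU nV VF]]].
have U0 : evC P U != 0 by apply/eqP => /(vanishes_atE _ hU).
have V0 : evC P V != 0 by apply/eqP => /(vanishes_atE _ hV).
have rV := rho_neq0 hV V0.
have hr : hdeg (du + k * d P) (U * T P ^+ k).
  by apply: hdegM => //; apply/hdegX/T_hdeg.
have [|e] := vanishes_onB_rho (hdegM hV hF) hr VF; first by rewrite rmorphM mulf_neq0.
rewrite !rmorphM rmorphXn /= => eF.
exists dv, (U * H P ^+ (k * d P)), V; split=> //.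
- rewrite e -[X in (_ + X)%N]muln1; apply: hdegM => //.
  exact/hdegX/H_hdeg.
- by rewrite evM evX mulf_neq0 ?expf_neq0 ?evH.
apply: (mulfI rV); rewrite eF rmorphM rmorphXn /= /loc exprMn exprVn -exprM.
rewrite (mulnC (d P)); field; by rewrite rV expf_neq0 ?rhoH_neq0.
Qed.

Lemma ord_at_exists P m F : hdeg m F -> rho F != 0 ->
  exists2 k, ord_at P m F k & local_order C (val P) (T P) F k.
Proof.
move=> hF F0; have [[_ _ _ unif] _ _ _] := TH P.
have [||k ok] := unif F; first by exists m.
  exact/(rho_neq0P hF).
by exists k => //; apply: local_order_ord.
Qed.

Lemma ord_at_gt0 P m F k : hdeg m F -> ord_at P m F k -> evC P F = 0 -> (0 < k)%N.
Proof.
move=> hF [p [A [B [hA hB A0 B0 e]]]] F0; rewrite lt0n; apply/eqP => k0.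
have : rho (B * F) = rho A.
  by rewrite rmorphM e k0 mulr1 mulrC divfK // (rho_neq0 hB B0).
move/(rho_eq_ev P (hdegM hB hF) hA); rewrite evM F0 mulr0 => /eqP.
by rewrite eq_sym (negPf A0).
Qed.

(** [order_at] allows any uniformizer [T']. If [T'] has order j with respect to [loc P] and [T P]
    has order i with respect to [T'], then ij = 1, so j = 1 and both measure the same order. *)
Lemma order_atE P m F k : hdeg m F -> rho F != 0 ->
  order_at P F k <-> ord_at P m F k.
Proof.
move=> hF F0; split=> [[T' uT' [U [V [[du hU] [dv hV] nU nV VF]]]]|oF].
  have [k0 ok0 _] := ord_at_exists P hF F0; suff <- : k0 = k by [].
  have [[d' hT'] _ nT' unif'] := uT'.
  have U0 : evC P U != 0 by apply/eqP => /(vanishes_atE _ hU).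
  have V0 : evC P V != 0 by apply/eqP => /(vanishes_atE _ hV).
  have T'0 : rho T' != 0 by apply/(rho_neq0P hT').
  have [j oj _] := ord_at_exists P hT' T'0.
  have cmp m1 F1 k1 i1 U1 V1 du1 dv1 : hdeg m1 F1 -> rho F1 != 0 ->
      ord_at P m1 F1 k1 -> hdeg du1 U1 -> hdeg dv1 V1 -> evC P U1 != 0 ->
      evC P V1 != 0 -> vanishes_on (V1 * F1 - U1 * T' ^+ i1) C -> k1 = (i1 * j)%N.
    move=> hF1 F10 o1 hU1 hV1 U10 V10 VF1.
    have [|e1 e2] := vanishes_onB_rho (hdegM hV1 hF1) (hdegM hU1 (hdegX i1 hT')) VF1.
      by rewrite rmorphM mulf_neq0 // (rho_neq0 hV1 V10).
    apply: ord_at_uniq e2; first exact: ord_atM (ord_at_unit hV1 V10) o1.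
    rewrite e1; exact: ord_atM (ord_at_unit hU1 U10) (ord_atX _ oj).
  have ek0 := cmp _ _ _ _ _ _ _ _ hF F0 ok0 hU hV U0 V0 VF.
  have [||i [U1 [V1 [[du1 hU1] [dv1 hV1] nU1 nV1 VF1]]]] := unif' (T P).
  - by exists (d P); apply: T_hdeg.
  - by apply/(rho_neq0P (T_hdeg P))/rhoT_neq0.
  have U10 : evC P U1 != 0 by apply/eqP => /(vanishes_atE _ hU1).
  have V10 : evC P V1 != 0 by apply/eqP => /(vanishes_atE _ hV1).
  have := cmp _ _ _ _ _ _ _ _ (T_hdeg P) (rhoT_neq0 P) (ord_at_loc P) hU1 hV1 U10 V10 VF1.
  move=> /esym/eqP; rewrite muln_eq1 => /andP [_ /eqP j1].
  by rewrite ek0 j1 muln1.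
have [k0 ok0 lo] := ord_at_exists P hF F0.
exists (T P); first by have [] := TH P.
by rewrite (ord_at_uniq oF ok0 erefl).
Qed.

Definition placed P f (k : int) : Prop := exists p A B,
  [/\ hdeg p A, hdeg p B, evC P A != 0, evC P B != 0
    & f = rho A / rho B * loc P ^ k].

Lemma placed_uniq P f k k' : placed P f k -> placed P f k' -> k = k'.
Proof.
wlog le_k : k k' / k <= k' => [IH pf pf'|].
  have [le_k|/ltW le_k] := lerP k k'; first exact: IH pf pf'.
  by apply/esym; apply: IH pf' pf.
move=> [p [A [B [hA hB A0 B0 ->]]]] [p' [A' [B' [hA' hB' A'0 B'0 e]]]].
have [j ej] : exists j : nat, k' = k + j by exists `|k' - k|%N; lia.
suff : j = 0%N by lia.
have B1 := rho_neq0 hB B0; have A'1 := rho_neq0 hA' A'0.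
have B'1 := rho_neq0 hB' B'0.
apply: (@unit_loc P (p + p') (A * B') (B * A')).
- exact: hdegM.
- exact: hdegM.
- by rewrite evM mulf_neq0.
- by rewrite evM mulf_neq0.
have lk : loc P ^ k != 0 by rewrite expfz_neq0 ?loc_neq0.
move: e; rewrite ej expfzDr ?loc_neq0 // !rmorphM -exprnP => e.
have e' : rho A / rho B = rho A' / rho B' * loc P ^+ j.
  by apply: (mulIf lk); rewrite e; ring.
have -> : rho A * rho B' / (rho B * rho A') = (rho A / rho B) * (rho B' / rho A').
  by field; rewrite B1 A'1.
by rewrite e'; field; rewrite B'1 A'1.
Qed.

Lemma placedM P f h k l : placed P f k -> placed P h l -> placed P (f * h) (k + l).
Proof.
move=> [p [A [B [hA hB A0 B0 ->]]]] [p' [A' [B' [hA' hB' A'0 B'0 ->]]]].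
exists (p + p')%N, (A * A'), (B * B'); split.
- exact: hdegM.
- exact: hdegM.
- by rewrite evM mulf_neq0.
- by rewrite evM mulf_neq0.
rewrite expfzDr ?loc_neq0 // !rmorphM.
have B1 := rho_neq0 hB B0; have B'1 := rho_neq0 hB' B'0.
by field; rewrite B1 B'1.
Qed.

Lemma placed_frac P m F G k l : hdeg m F -> hdeg m G ->
  ord_at P m F k -> ord_at P m G l -> placed P (rho F / rho G) (k%:Z - l%:Z).
Proof.
move=> hF hG [p [A [B [hA hB A0 B0 ->]]]] [p' [A' [B' [hA' hB' A'0 B'0 ->]]]].
exists (p + m + p')%N, (A * B'), (B * A'); split.
- exact: hdegM.
- by rewrite -addnA (addnC m); apply: hdegM.
- by rewrite evM mulf_neq0.
- by rewrite evM mulf_neq0.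
rewrite expfzDr ?loc_neq0 // -invr_expz -!exprnP !rmorphM.
have B1 := rho_neq0 hB B0; have A'1 := rho_neq0 hA' A'0.
have B'1 := rho_neq0 hB' B'0.
by field; rewrite B1 B'1 A'1 expf_neq0 ?loc_neq0.
Qed.

Lemma placed_exists P f : f != 0 -> exists k, placed P f k.
Proof.
have [m [F [G [hF hG G0 ->]]]] := rho_frac f => fG.
have F0 : rho F != 0 by apply: contraNneq fG => ->; rewrite mul0r.
have [k ok _] := ord_at_exists P hF F0; have [l ol _] := ord_at_exists P hG G0.
by exists (k%:Z - l%:Z); exact: placed_frac hF hG ok ol.
Qed.

(** For f = 0 no k qualifies and the default 0 is returned; [vge] treats 0 apart. *)
Definition val_at P f : int := xget 0 [set k | placed P f k].

Lemma val_atP P f : f != 0 -> placed P f (val_at P f).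
Proof.
by move=> /(placed_exists P) [k pk]; apply: (@xgetPex _ 0 (placed P f)); exists k.
Qed.

Lemma val_atE P f k : placed P f k -> val_at P f = k.
Proof.
move=> pk; apply: placed_uniq (pk).
by apply: (@xgetPex _ 0 (placed P f)); exists k.
Qed.

Definition regular_at P f : Prop := exists p A B,
  [/\ hdeg p A, hdeg p B, evC P B != 0 & f = rho A / rho B].

Lemma regularD P f h : regular_at P f -> regular_at P h -> regular_at P (f + h).
Proof.
move=> [p [A [B [hA hB B0 ->]]]] [p' [A' [B' [hA' hB' B'0 ->]]]].
exists (p + p')%N, (A * B' + B * A'), (B * B'); split.
- by apply: rpredD; apply: hdegM.
- exact: hdegM.
- by rewrite evM mulf_neq0.
have B1 := rho_neq0 hB B0; have B'1 := rho_neq0 hB' B'0.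
by rewrite rmorphD !rmorphM; field; rewrite B1 B'1.
Qed.

Lemma regularM P f h : regular_at P f -> regular_at P h -> regular_at P (f * h).
Proof.
move=> [p [A [B [hA hB B0 ->]]]] [p' [A' [B' [hA' hB' B'0 ->]]]].
exists (p + p')%N, (A * A'), (B * B'); split.
- exact: hdegM.
- exact: hdegM.
- by rewrite evM mulf_neq0.
have B1 := rho_neq0 hB B0; have B'1 := rho_neq0 hB' B'0.
by rewrite !rmorphM; field; rewrite B1 B'1.
Qed.

Lemma regular_locX P j : regular_at P (loc P ^+ j).
Proof.
elim: j => [|j IH].
  exists 0%N, 1, 1; split; rewrite ?ev1 ?oner_neq0 ?rmorph1 ?divr1 //; exact: hdeg1.
rewrite exprS; apply: regularM => //.
exists (d P), (T P), (H P ^+ d P); split.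
- exact: T_hdeg.
- by rewrite -[X in hdeg X]muln1; apply/hdegX/H_hdeg.
- by rewrite evX expf_neq0 ?evH.
by rewrite rmorphXn.
Qed.

Lemma regular_val P f : f != 0 -> regular_at P f <-> 0 <= val_at P f.
Proof.
move=> f0; split=> [[p [A [B [hA hB B0 e]]]]|].
  have A0 : rho A != 0 by apply: contraNneq f0 => A0; rewrite e A0 mul0r.
  have [k ok _] := ord_at_exists P hA A0.
  have := placed_frac hA hB ok (ord_at_unit hB B0).
  by rewrite -e => /val_atE ->; rewrite subr0.
have [p [A [B [hA hB A0 B0 e]]]] := val_atP P f0.
case: (val_at P f) e => // k e _; rewrite e; apply: regularM.
  by exists p, A, B.
exact: regular_locX.
Qed.

Lemma placed_loc P (k : int) : placed P (loc P ^ k) k.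
Proof.
exists 0%N, 1, 1; rewrite ev1 oner_neq0 rmorph1 divr1 mul1r.
by split=> //; apply: hdeg1.
Qed.

(** This reduces the ultrametric inequality to the stability of the local ring under addition. *)
Lemma vge_regular P f (k : int) :
  vge val_at P f k <-> regular_at P (f * loc P ^ (- k)).
Proof.
have lk : loc P ^ (- k) != 0 by rewrite expfz_neq0 ?loc_neq0.
have [->|f0] := eqVneq f 0.
  rewrite /vge eqxx mul0r; split=> // _; exists 0%N, 0, 1.
  rewrite ev1 oner_neq0 rmorph0 mul0r; split=> //; first exact: rpred0.
  exact: hdeg1.
rewrite (regular_val _ (mulf_neq0 f0 lk)).
rewrite (val_atE (placedM (val_atP P f0) (placed_loc P _))).
by rewrite /vge (negPf f0) subr_ge0.
Qed.

Definition constant : {rmorphism R[i] -> K} := rho \o @mpolyC n.+1 R[i].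

(** Where [U] is nonzero, a zero of F is a zero of [T P]. The linear forms [l j] vanish at P, hence
    are multiples of [T P] near P, and their only common zero is P. *)
Lemma form_zeros_near P F m : hdeg m F -> rho F != 0 -> exists W,
  [/\ form W, evC P W != 0 &
    forall Q, evC Q W != 0 -> evC Q F = 0 -> Q = P].
Proof.
move=> hF F0.
have [k _ [U [V [[du hU] [dv hV] nU nV VF]]]] := ord_at_exists P hF F0.
have U0 : evC P U != 0 by apply/eqP => /(vanishes_atE _ hU).
have /rV0Pn [i Pi] := rep_neq0 (val P).
pose l j : mp := rep (val P) 0 i *: 'X_j - rep (val P) 0 j *: 'X_i.
have hl j : hdeg 1 (l j) by apply: hdegB; apply/hdegZ/hdegXi.
have evl Q j : evC Q (l j) =
    rep (val P) 0 i * rep (val Q) 0 j - rep (val P) 0 j * rep (val Q) 0 i.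
  by rewrite evB !evZ !evXi.
have /choice [N NP] : forall j, exists N : mp * nat, [/\ hdeg N.2 N.1, evC P N.1 != 0 &
    forall Q, evC Q N.1 != 0 -> evC Q (T P) = 0 -> evC Q (l j) = 0].
  move=> j; have [lj0|lj0] := eqVneq (rho (l j)) 0.
    exists (1, 0%N); rewrite /= ev1 oner_neq0; split=> //; first exact: hdeg1.
    by move=> Q _ _; apply: (proj1 (vanishes_onP (hl j))); apply/(rho_eq0 (hl j)).
  have [k' ok' [U' [V' [_ [dv' hV'] _ nV' VF']]]] := ord_at_exists P (hl j) lj0.
  exists (V', dv'); split=> //=; first by apply/eqP => /(vanishes_atE _ hV').
  move=> Q V'0 TQ; have := vanishes_ev (VF' _ (point_mem Q)).
  have k'0 : (0 < k')%N.
    by apply: ord_at_gt0 (hl j) ok' _; rewrite evl mulrC subrr.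
  rewrite evB !evM evX TQ expr0n (gtn_eqF k'0) mulr0 subr0 => /eqP.
  by rewrite mulf_eq0 (negPf V'0) => /eqP.
exists (U * \prod_j (N j).1); split.
- exists (du + \sum_j (N j).2)%N; apply: hdegM => //.
  by apply: hdeg_prod => j; have [] := NP j.
- rewrite evM ev_prod mulf_neq0 //; apply/prodf_neq0 => j _.
  by have [] := NP j.
move=> Q; rewrite evM ev_prod mulf_eq0 negb_or => /andP [UQ /prodf_neq0 NQ] FQ.
have TQ : evC Q (T P) = 0.
  have := vanishes_ev (VF _ (point_mem Q)).
  rewrite evB !evM FQ mulr0 sub0r evX => /eqP.
  rewrite oppr_eq0 mulf_eq0 (negPf UQ) expf_eq0 => /andP [_ /eqP].
  by [].
apply: val_inj; apply: (point_eq Pi) => j.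
have [_ _ /(_ Q (NQ j isT) TQ)] := NP j.
by rewrite evl => /eqP; rewrite subr_eq0 => /eqP.
Qed.

(** The sets where some W in [S] is nonzero each contain at most one zero of F and together cover
    all these zeros; [finite_zeros] extracts a finite subcover. *)
Lemma form_zeros_finite F m : hdeg m F -> rho F != 0 ->
  exists s : seq pt, forall P, evC P F = 0 -> P \in s.
Proof.
move=> hF F0.
pose S W := exists P, forall Q, evC Q W != 0 -> evC Q F = 0 -> Q = P.
have [s sS sP] := @finite_zeros R[i] n.+1 S.
have /choice [near nearP] : forall W, exists P : pt, S W ->
    forall Q, evC Q W != 0 -> evC Q F = 0 -> Q = P.
  move=> W; have [[P PW]|nS] := pselect (S W); first by exists P.
  have [[_ [P CP] _] _ _] := C_curve.
  by exists (SigSub (mem_set CP)).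
exists [seq near W | W <- s] => Q FQ.
have [W Ws WQ] : exists2 W, W \in s & evC Q W != 0.
  apply: contrapT => /forall2NP no.
  have [W [_ WQ PW]] := form_zeros_near Q hF F0.
  move/eqP: WQ; apply; apply: (sP (rep (val Q) 0)); last by exists Q.
  by move=> W' W's; have [|/negP/negPn/eqP] := no W'.
by apply/mapP; exists W => //; apply: nearP => //; apply: sS.
Qed.

Lemma form_divisor_exists F m : hdeg m F -> rho F != 0 ->
  exists DF : divisor C, form_divisor F DF.
Proof.
move=> hF F0; have [s sP] := form_zeros_finite hF F0.
have /choice [k kP] : forall P, exists k : nat, ord_at P m F k.
  by move=> P; have [k ok _] := ord_at_exists P hF F0; exists k.
have [D DP] : exists D : divisor C, forall P, coeff P D = (k P)%:Z.
  apply: (@finite_support_divisor _ _ s) => P kP0; apply: sP.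
  apply/eqP; apply: contraNT kP0 => FP.
  by rewrite (ord_at_uniq (kP P) (ord_at_unit hF FP) erefl).
by exists D => P; exists (k P); [apply: (proj2 (order_atE _ _ hF F0)) | ].
Qed.

Lemma fun_divisorE F G E m : hdeg m F -> hdeg m G -> rho F != 0 -> rho G != 0 ->
  fun_divisor F G E <-> forall P : pt, coeff P E = val_at P (rho F / rho G).
Proof.
move=> hF hG F0 G0.
have valE P k l : order_at P F k -> order_at P G l ->
    val_at P (rho F / rho G) = k%:Z - l%:Z.
  move=> /(order_atE _ _ hF F0) oF /(order_atE _ _ hG G0) oG.
  exact: (val_atE (placed_frac hF hG oF oG)).
split=> [[DF [DG [DFP DGP ->]]] P|EP].
  have [k oF eF] := DFP P; have [l oG eG] := DGP P.
  by rewrite coeffB eF eG (valE _ _ _ oF oG).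
have [DF DFP] := form_divisor_exists hF F0.
have [DG DGP] := form_divisor_exists hG G0.
exists DF, DG; split=> //; apply/eqP/freeg_eqP => P.
have [k oF eF] := DFP P; have [l oG eG] := DGP P.
by rewrite EP coeffB eF eG (valE _ _ _ oF oG).
Qed.

Lemma function_field_val_at : function_field constant val_at.
Proof.
split.
- move=> P f h f0 h0; apply/val_atE/placedM; exact: val_atP.
- move=> P f h k /vge_regular rf /vge_regular rh; apply/vge_regular.
  by rewrite mulrDl; apply: regularD.
- move=> P c c0; apply: val_atE; exists 0%N, c%:MP, 1.
  rewrite ev_const ev1 oner_neq0 rmorph1 divr1 mulr1; split=> //.
  + exact: hdegC.
  + exact: hdeg1.
- move=> P f f0 vf; have := val_atP P f0; rewrite vf.
  move=> [p [A [B [hA hB A0 B0 e]]]]; rewrite mulr1 in e.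
  (* The residue is the value A(P) / B(P), and A - cB vanishes at P. *)
  have [c cE] : exists c, c * evC P B = evC P A.
    by exists (evC P A / evC P B); rewrite divfK.
  exists c; pose N := A - c *: B.
  have hN : hdeg p N by apply: hdegB => //; apply: hdegZ.
  have NP : evC P N = 0 by rewrite evB evZ cE subrr.
  have B1 := rho_neq0 hB B0.
  have -> : f - constant c = rho N / rho B.
    have -> : constant c = rho c%:MP by [].
    by rewrite e /N rmorphB -mul_mpolyC rmorphM; field.
  rewrite /vge; case: eqVneq => //= NB.
  have N0 : rho N != 0 by apply: contraNneq NB => ->; rewrite mul0r.
  have [k ok _] := ord_at_exists P hN N0.
  rewrite (val_atE (placed_frac hN hB ok (ord_at_unit hB B0))) subr0.
  exact: ord_at_gt0 hN ok NP.
move=> f f0; have [m [F [G [hF hG G0 e]]]] := rho_frac f.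
have F0 : rho F != 0 by apply: contraNneq f0 => F0; rewrite e F0 mul0r.
have [DF DFP] := form_divisor_exists hF F0.
have [DG DGP] := form_divisor_exists hG G0.
exists (DF - DG); rewrite e; apply/(fun_divisorE _ hF hG F0 G0).
by exists DF, DG.
Qed.

(** * Sections, genus and semigroups in terms of the function field *)

Lemma common_denominator r (f : 'I_r -> K) : exists m s G,
  [/\ forall j, hdeg m (s j), hdeg m G, rho G != 0
    & forall j, f j = rho (s j) / rho G].
Proof.
have /choice [x xP] : forall j, exists x : nat * mp * mp,
    [/\ hdeg x.1.1 x.1.2, hdeg x.1.1 x.2, rho x.2 != 0 & f j = rho x.1.2 / rho x.2].
  by move=> j; have [m [F [G ?]]] := rho_frac (f j); exists (m, F, G).
exists (\sum_j (x j).1.1)%N,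
  (fun j => (x j).1.2 * \prod_(i | i != j) (x i).2), (\prod_j (x j).2).
have Gdeg j : hdeg (x j).1.1 (x j).2 by have [] := xP j.
have G0 j : rho (x j).2 != 0 by have [] := xP j.
split.
- move=> j; rewrite (bigD1 j) //=; apply: hdegM; first by have [] := xP j.
  exact: hdeg_prod.
- exact: hdeg_prod.
- by rewrite rmorph_prod; apply/prodf_neq0.
move=> j; have [_ _ _ ->] := xP j.
rewrite [X in _ = _ / rho X](bigD1 j) //= !rmorphM rmorph_prod.
have : \prod_(i | i != j) rho (x i).2 != 0 by apply/prodf_neq0.
by move: (\prod_(_ | _) _) => p p0; field; rewrite p0 G0.
Qed.

Lemma hdeg_lin_comb m r (s : 'I_r -> mp) c :
  (forall j, hdeg m (s j)) -> hdeg m (lin_comb s c).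
Proof. by move=> hs; apply: hdeg_sum => j _; apply: hdegZ. Qed.

Lemma rho_lin_comb r (s : 'I_r -> mp) G (f : 'I_r -> K) c :
  (forall j, f j = rho (s j) / rho G) ->
  rho (lin_comb s c) / rho G = comb constant f c.
Proof.
move=> fE; rewrite /lin_comb rmorph_sum /= mulr_suml /comb; apply: eq_bigr => j _.
by rewrite -mul_mpolyC rmorphM -mulrA -fE.
Qed.

Lemma independent_sectionsE D r m (s : 'I_r -> mp) G (f : 'I_r -> K) :
  (forall j, hdeg m (s j)) -> hdeg m G -> rho G != 0 ->
  (forall j, f j = rho (s j) / rho G) ->
  independent_sections D s G <-> indep constant val_at D f.
Proof.
move=> hs hG G0 fE; have hlc c := hdeg_lin_comb c hs.
have lcE c := rho_lin_comb c fE.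
have lc0 c : comb constant f c != 0 <-> rho (lin_comb s c) != 0.
  by rewrite -lcE mulf_eq0 invr_eq0 (negPf G0) orbF.
split=> [[m' [_ _ _ ind]] c c0|ind].
  have [nlc [E EP DE]] := ind c c0.
  have rlc0 := proj1 (rho_neq0P (hlc c)) nlc.
  have cf0 := proj2 (lc0 c) rlc0; split=> // P.
  move/(fun_divisorE _ (hlc c) hG rlc0 G0): EP => EP.
  rewrite /vge (negPf cf0) /= -lcE -EP; have := DE P; rewrite coeffD; lia.
exists m; split=> //; first exact/(rho_neq0P hG).
move=> c c0; have [cf0 cfD] := ind c c0; have rlc0 := proj1 (lc0 c) cf0.
split; first exact/(rho_neq0P (hlc c)).
have [E EP] := ff_div function_field_val_at cf0.
exists E; first by apply/(fun_divisorE _ (hlc c) hG rlc0 G0) => P; rewrite lcE.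
move=> P; rewrite coeffD EP; have := cfD P; rewrite /vge (negPf cf0) /=; lia.
Qed.

Lemma ell_geE D r : ell_ge D r <-> exists f : 'I_r -> K, indep constant val_at D f.
Proof.
split=> [[s [G sG]]|[f fD]].
  have [m [hs hG nG _]] := sG; have G0 := proj1 (rho_neq0P hG) nG.
  exists (fun j => rho (s j) / rho G).
  exact/(independent_sectionsE _ hs hG G0 (fun=> erefl)).
have [m [s [G [hs hG G0 fE]]]] := common_denominator f.
by exists s, G; apply/(independent_sectionsE _ hs hG G0 fE).
Qed.

Lemma riemann_boundE g : riemann_bound C g <-> riemann constant val_at g.
Proof. by split=> rb D r Dr; apply/ell_geE/rb. Qed.

Lemma is_linear_systemE a (L : set (divisor C)) : is_linear_system 1 a L <->
  exists D (f : 'I_2 -> K), [/\ deg D = a%:Z, indep constant val_at D f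
    & L = [set E | pencil constant val_at D f E]].
Proof.
have key D m s G (f : 'I_2 -> K) : (forall j, hdeg m (s j)) -> hdeg m G ->
    rho G != 0 -> (forall j, f j = rho (s j) / rho G) ->
    indep constant val_at D f ->
    [set E | exists2 c : 'I_2 -> R[i], (exists j, c j != 0)
           & fun_divisor (lin_comb s c) G (E - D)]
    = [set E | pencil constant val_at D f E].
  move=> hs hG G0 fE fD.
  have fdE c E : (exists j, c j != 0) -> fun_divisor (lin_comb s c) G (E - D) <->
      forall P, coeff P (E - D) = val_at P (comb constant f c).
    move=> c0; have [cf0 _] := fD c c0.
    rewrite -(rho_lin_comb c fE); apply: (fun_divisorE _ (hdeg_lin_comb c hs) hG) => //.
    apply: contraNneq cf0 => lc0.
    by rewrite -(rho_lin_comb c fE) lc0 mul0r.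
  by apply/seteqP; split=> E /= [c c0 /(fdE c E c0) Ec]; exists c.
split=> [[D [s [G [dD sD LE]]]]|[D [f [dD fD LE]]]].
  have [m [hs hG nG _]] := sD; have G0 := proj1 (rho_neq0P hG) nG.
  have fD := proj1 (independent_sectionsE D hs hG G0 (fun=> erefl)) sD.
  exists D, (fun j => rho (s j) / rho G); split=> //.
  by rewrite LE (key D m s G _ hs hG G0 (fun=> erefl)).
have [m [s [G [hs hG G0 fE]]]] := common_denominator f.
exists D, s, G; split=> //.
  exact/(independent_sectionsE _ hs hG G0 fE).
by rewrite LE (key D m s G f).
Qed.

(** The members of |mP| are the divisors mP + div f with f in L(mP); such a divisor avoids Q when f
    has at Q the exact order allowed. *)
Lemma weierstrass_semigroupE (P : pt) (m : nat) : weierstrass_semigroup P m <->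
  (m = 0%N \/ forall Q, exists f, [/\ f != 0,
     inL val_at << m%:Z *g P >> f & val_at Q f = - coeff Q << m%:Z *g P >>]).
Proof.
set D := << _ *g _ >>.
split=> -[->|bpf]; [by left|right|by left|right] => Q.
  have [E [E0 [m' [F [G [hF hG nF nG FG]]]]] EQ] := bpf Q.
  have F0 := proj1 (rho_neq0P hF) nF; have G0 := proj1 (rho_neq0P hG) nG.
  have fG0 : rho F / rho G != 0 by rewrite mulf_neq0 ?invr_eq0.
  move/(fun_divisorE _ hF hG F0 G0): FG => FG.
  exists (rho F / rho G); split=> // [S|]; last by rewrite -FG coeffB EQ sub0r.
  rewrite /vge (negPf fG0) /= -FG coeffB lerBrDr addNr; exact: E0.
have [f [f0 fD fQ]] := bpf Q; have [E EP] := ff_div function_field_val_at f0.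
exists (D + E); last by rewrite coeffD EP fQ subrr.
split=> [S|].
  by rewrite coeffD EP -lerBlDl sub0r; have := fD S; rewrite /vge (negPf f0).
have [m' [F [G [hF hG G0 fE]]]] := rho_frac f.
have F0 : rho F != 0 by apply: contraNneq f0 => F0; rewrite fE F0 mul0r.
exists m', F, G; split=> //; [exact/(rho_neq0P hF) | exact/(rho_neq0P hG) |].
apply/(fun_divisorE _ hF hG F0 G0) => S.
by rewrite addrC addKr EP fE.
Qed.

End Places.

End Curve.

(** * Existence and uniqueness of the pencil on the curve *)

Lemma has_genus_uniq (R : realType) (n : nat) (C : set (proj_space R n)) g g' :
  has_genus C g -> has_genus C g' -> g = g'.
Proof.
by move=> [rg mg] [rg' mg']; apply/eqP; rewrite eqn_leq mg // mg'.
Qed.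

Theorem proposition1 (R : realType) (n : nat) (C : set (proj_space R n))
    (a b : nat) (a_gt0 : (0 < a)%N) (a_lt_b : (a < b)%N)
    (coprime_ab : coprime a b)
    (C_curve : smooth_projective_curve C)
    (C_genus : has_genus C ((a - 1) * (b - 1) %/ 2)%N)
    (C_point : exists2 P : set_type C, weierstrass_point P
                 & weierstrass_semigroup P = semigroup_gen2 a b)
    (b_neq : b <> (a + 1)%N) :
  exists! L : set (divisor C), is_linear_system 1 a L.
Proof.
have [P [g' g'_genus nWS] WS] := C_point.
(* For a = 1 the genus is 0 and the semigroup is all of N, so P would not be a Weierstrass point. *)
have a_gt1 : (1 < a)%N.
  rewrite ltn_neqAle a_gt0 andbT; apply/eqP => a1; case: nWS.
  have -> : g' = 0%N by rewrite (has_genus_uniq g'_genus C_genus) -a1.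
  rewrite WS -a1; apply/seteqP; split=> m /=; last by lia.
  by case; exists m, 0%N; lia.
have [K [rho [rho0 rhof]]] := function_field_exists C_curve.
have [T [d [H TH]]] := uniformizer_choice C_curve.
have ff := function_field_val_at C_curve rho0 rhof TH.
set g := (_ %/ 2)%N in C_genus.
(* The division by 2 is exact: a and b, being coprime, are not both even. *)
have g_ab : (2 * g = (a - 1) * (b - 1))%N.
  rewrite mulnC divnK // dvdn2 oddM !oddB //; last by lia.
  have : odd a || odd b.
    apply: contraT; rewrite negb_or -!dvdn2 -dvdn_gcd.
    by rewrite (eqP (coprime_ab : gcdn a b == 1%N)).
  by case: (odd a); case: (odd b).
have g_gt0 : (0 < g)%N by nia.
have [/(riemann_boundE C_curve rho0 rhof TH) rg mg] := C_genus.
have semigroup_P m : semigroup_gen2 a b m <-> (m = 0%N \/ forall Q, exists f,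
    [/\ f != 0, inL (val_at rho T d H) << m%:Z *g P >> f
      & val_at rho T d H Q f = - coeff Q << m%:Z *g P >>]).
  by rewrite -(weierstrass_semigroupE C_curve rho0 rhof TH) WS.
have g_min g1 : riemann (constant rho) (val_at rho T d H) g1 -> (g <= g1)%N.
  by move/(riemann_boundE C_curve rho0 rhof TH)/mg.
have lt_b : (a + 1 < b)%N by lia.
have [x [xI uniq]] := unique_pencil ff g_gt0 rg g_min a_gt1 lt_b coprime_ab
  g_ab semigroup_P.
have LE := is_linear_systemE C_curve rho0 rhof TH a.
(* The witness, found by unification, is the pencil spanned by 1 and x in L(aP). *)
eexists; split.
  by apply/LE; do 2 eexists; split; [exact: degU | exact: xI | reflexivity].
move=> L /LE [D [f [dD fD ->]]]; apply/seteqP.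
by split=> E /(uniq D f E dD fD).
Qed.
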